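(* Let $\mathbb K$ be a local field of characteristic different from $2$, or a quaternion division algebra over such a local field. Let $\sigma$ be a (possibly trivial) involutive anti-automorphism of $\mathbb K$; if $\mathbb K$ is a quaternion division algebra which is not the Hamilton quaternion algebra, assume that $\sigma$ is the standard quaternionic involution. Let $V$ be a finite-dimensional right $\mathbb K$-vector space of dimension at least $5$, and let $q$ be a nondegenerate $\sigma$-Hermitian form on $V$ of Witt index $2$. Let $\mathcal I$ be the flag complex of nonzero totally isotropic subspaces of $V$ and let $\mathcal A$ be an apartment of $\mathcal I$. Then every element of $\operatorname{Mor}(\mathcal A,\mathcal I)$ whose image is not a quadripod belongs to $\overline{\operatorname{Mor}_{inj}(\mathcal A,\mathcal I)}^g$.
   Context: A local field is a field with a non-trivial valuation (absolute value), complete and locally compact: $\mathbb R$, $\mathbb C$, a finite extension of $\mathbb Q_p$, or $\mathbb F_q((t))$. A $\sigma$-Hermitian form is given by $\varphi:V\times V\to\mathbb K$, additive in each variable, with $\varphi(vx,wy)=\sigma(x)\varphi(v,w)y$ and $\varphi(w,v)=\sigma(\varphi(v,w))$; $q(v)=\varphi(v,v)$. Witt index $2$ means that all maximal totally isotropic subspaces have dimension $2$. The standard quaternionic involution sends $i,j,k=ij$ to $-i,-j,-k$ and fixes the centre. $\mathcal I$ is a spherical building of type $C_2$: its vertices are the isotropic lines and the totally isotropic $2$-planes of $V$, and its edges (Weyl chambers) are the pairs (isotropic line $\subset$ totally isotropic plane). The space $\operatorname{Cham}(\mathcal I)$ of edges has the compact topology induced by $\mathbb P(V)\times \mathcal{G}r_2(V)$.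 An apartment is an octagon. $\operatorname{Mor}(\mathcal A,\mathcal I)$ is the set of all (not necessarily injective) type-preserving simplicial morphisms $\mathcal A\to\mathcal I$, with the topology induced by the product topology on $\operatorname{Cham}(\mathcal I)^{\operatorname{Cham}(\mathcal A)}$; $\operatorname{Mor}_{inj}(\mathcal A,\mathcal I)$ is the subset of injective ones and $\overline{\operatorname{Mor}_{inj}(\mathcal A,\mathcal I)}^g$ is its closure in $\operatorname{Mor}(\mathcal A,\mathcal I)$. A quadripod is a union of four pairwise distinct edges of $\mathcal I$ whose intersection is a vertex. *)

(* Defs.v *)
From HB Require Import structures.
From mathcomp Require Import all_boot all_order all_algebra all_field.
From mathcomp Require Import all_classical all_reals all_analysis.

Set Implicit Arguments.
Unset Strict Implicit.
Unset Printing Implicit Defensive.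

Import Order.TTheory GRing.Theory Num.Theory VectorInternalTheory.

Local Open Scope classical_set_scope.
Local Open Scope ring_scope.

(** * Local fields *)

(* The library's norms are not usable here: their axiom
   `|x *+ n| = `|x| *+ n excludes ultrametric absolute values. *)
Record absolute_value (R : realType) (F : fieldType) := AbsoluteValue {
  absv :> F -> R;
  absv_ge0 : forall x, 0 <= absv x;
  absv_eq0 : forall x, absv x = 0 <-> x = 0;
  absvM : forall x y, absv (x * y) = absv x * absv y;
  absvD : forall x y, absv (x + y) <= absv x + absv y
}.

(* F, with the metric a (x - y). *)
Definition valued {R : realType} {F : fieldType} (a : absolute_value R F) :
  Type := F.

Section AbsoluteValueTopology.
Context {R : realType} {F : fieldType} (a : absolute_value R F).

Let dist (x y : valued a) : R := a ((x : F) - (y : F)).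

Let distxx x : dist x x = 0.
Proof. by apply/absv_eq0; rewrite subrr. Qed.

Let dist_positivity x y : dist x y = 0 -> x = y.
Proof. by move/absv_eq0/eqP; rewrite subr_eq0 => /eqP. Qed.

Let absvN x : a (- x) = a x.
Proof.
have a1 : a 1 = 1.
  have a10 : a 1 != 0.
    by apply/eqP => /absv_eq0/eqP; rewrite oner_eq0.
  by apply: (mulfI a10); rewrite -absvM !mulr1.
have aN1 : a (- 1) = 1.
  apply/eqP; rewrite -(@eqrXn2 _ 2) ?absv_ge0//.
  by rewrite expr2 -absvM mulrNN mulr1 a1 expr1n.
by rewrite -mulN1r absvM aN1 mul1r.
Qed.

Let dist_sym x y : dist x y = dist y x.
Proof. by rewrite /dist -opprB absvN. Qed.

Let dist_triangle y x z : dist x z <= dist x y + dist y z.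
Proof.
by rewrite /dist (_ : (x : F) - z = (x - y) + (y - z)) ?absvD// addrA subrK.
Qed.

HB.instance Definition _ := Choice.copy (valued a) F.
HB.instance Definition _ := isMetric.Build R (valued a)
  distxx dist_positivity dist_sym dist_triangle.

Definition local_field : Prop :=
  [/\ exists2 x, x != 0 & a x != 1,
      forall G : set_system (valued a),
        ProperFilter G -> cauchy G -> exists x : valued a, G --> x
    & locally_compact [set: valued a]].

End AbsoluteValueTopology.

(** * Quaternion algebras *)

Section Quaternion.
Context {F : fieldType} {K : falgType F}.

Definition is_base_field := forall x : K, exists c : F, x = c%:A.

(* Over a field F of characteristic different from 2. *)
Definition quaternion_basis (c d : F) (i j : K) : Prop :=
  [/\ c != 0, d != 0 & [/\ i * i = c%:A, j * j = d%:A, i * j = - (j * i)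
    & basis_of {:K} [:: 1; i; j; i * j]]].

Definition quaternion_algebra : Prop :=
  exists (c d : F) (i j : K), quaternion_basis c d i j.

Definition division_algebra := forall x : K, x != 0 -> x \is a GRing.unit.

Definition hamilton_quaternion (R : realType) : Prop :=
  (exists f : {rmorphism F -> R}, bijective f) /\
  (exists i j : K, quaternion_basis (-1) (-1) i j).

(* The scalars are the centre of a quaternion algebra. *)
Definition standard_involution (sigma : K -> K) : Prop :=
  exists (c d : F) (i j : K),
    [/\ quaternion_basis c d i j,
        [/\ sigma i = - i, sigma j = - j & sigma (i * j) = - (i * j)]
      & forall e : F, sigma e%:A = e%:A].

End Quaternion.

Arguments is_base_field {F} K.
Arguments quaternion_algebra {F} K.
Arguments division_algebra {F} K.
Arguments hamilton_quaternion {F} K R.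

(** * Right vector spaces *)

(* A right K-vector space is a left vector space over the converse ring K^c. *)
Section RightSpaces.
Context {F : fieldType} {K : falgType F} {V : vectType K^c}.

Definition rscale (v : V) (x : K) : V := (x : K^c) *: v.

Definition rcomb k (s : 'I_k -> V) (c : 'I_k -> K) : V :=
  \sum_(i < k) rscale (s i) (c i).

Definition rspan k (s : 'I_k -> V) : set V := range (rcomb s).

Definition rfree k : set ('I_k -> V) :=
  [set s | forall c : 'I_k -> K, rcomb s c = 0 -> forall i, c i = 0].

Definition rsubspace (U : set V) : Prop :=
  U 0 /\ forall u v x, U u -> U v -> U (u + rscale v x).

Definition has_rdim (k : nat) (U : set V) : Prop :=
  exists2 s : 'I_k -> V, rfree s & U = rspan s.

End RightSpaces.

Record grass {F : fieldType} {K : falgType F} (k : nat) (V : vectType K^c) :=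
  Grass {
    gset :> set V;
    grass_dim : has_rdim k gset
  }.

(** * Hermitian forms and the flag complex *)

Section Hermitian.
Context {F : fieldType} {K : falgType F} {V : vectType K^c} {sigma : K -> K}.

Record hermitian_form := HermitianForm {
  hform :> V -> V -> K;
  hformDl : forall u v w, hform (u + v) w = hform u w + hform v w;
  hformDr : forall u v w, hform w (u + v) = hform w u + hform w v;
  hformZ : forall v w x y,
    hform (rscale v x) (rscale w y) = sigma x * hform v w * y;
  hform_sym : forall v w, hform w v = sigma (hform v w)
}.

Variable phi : hermitian_form.

Definition nondegenerate_form : Prop :=
  forall v : V, (forall w : V, phi v w = 0) -> v = 0.

Definition totally_isotropic (U : set V) : Prop :=
  forall u v, U u -> U v -> phi u v = 0.

Definition maximal_totally_isotropic (U : set V) : Prop :=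
  [/\ rsubspace U, totally_isotropic U
    & forall W : set V, rsubspace W -> totally_isotropic W ->
        U `<=` W -> W = U].

Definition witt_index (m : nat) : Prop :=
  forall U : set V, maximal_totally_isotropic U -> has_rdim m U.

(* For Witt index 2, these are the vertices and the edges of the flag complex
   of nonzero totally isotropic subspaces. *)
Definition isoline : set (grass 1 V) := [set L | totally_isotropic L].
Definition isoplane : set (grass 2 V) := [set P | totally_isotropic P].
Definition chamber : set (grass 1 V * grass 2 V) :=
  [set c | [/\ isoline c.1, isoplane c.2 & (c.1 : set V) `<=` c.2]].

(* An octagon, given by its set of edges: its vertices are, in cyclic order,
   P 0, L 0, P 1, L 1, P 2, L 2, P 3, L 3. *)
Definition apartment (A : set (grass 1 V * grass 2 V)) : Prop :=
  A `<=` chamber /\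
  exists (L : 'I_4 -> grass 1 V) (P : 'I_4 -> grass 2 V),
    [/\ injective L, injective P
      & A = range (fun i => (L i, P i)) `|` range (fun i => (L i, P (ordS i)))].

Definition edge_vertices (c : grass 1 V * grass 2 V) :
    set (grass 1 V + grass 2 V) :=
  [set inl c.1; inr c.2].

(* A union of edges is represented by the set of these edges. *)
Definition quadripod (Q : set (grass 1 V * grass 2 V)) : Prop :=
  exists e : 'I_4 -> grass 1 V * grass 2 V,
    [/\ injective e, forall i, chamber (e i), Q = range e
      & exists x, \bigcap_i edge_vertices (e i) = [set x]].

Section Morphisms.
Variable A : set (grass 1 V * grass 2 V).

Definition line_of (c : A) : fst @` A :=
  SigSub (mem_set (imageP fst (set_mem (valP c)))).
Definition plane_of (c : A) : snd @` A :=
  SigSub (mem_set (imageP snd (set_mem (valP c)))).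

(* Type-preserving maps on the vertices of A which send edges to edges. *)
Record mor := Mor {
  mor_line : fst @` A -> isoline;
  mor_plane : snd @` A -> isoplane;
  mor_incident : forall c : A,
    (val (mor_line (line_of c)) : set V) `<=` val (mor_plane (plane_of c))
}.

Lemma mor_chamber_subproof (f : mor) (c : A) :
  chamber (val (mor_line f (line_of c)), val (mor_plane f (plane_of c))).
Proof.
split; [exact: (set_mem (valP (mor_line f (line_of c))))| |exact: mor_incident].
exact: (set_mem (valP (mor_plane f (plane_of c)))).
Qed.

Definition mor_chamber (f : mor) (c : A) : chamber :=
  SigSub (mem_set (mor_chamber_subproof f c)).

Definition mor_inj : set mor :=
  [set f | injective (mor_line f) /\ injective (mor_plane f)].

Definition mor_image (f : mor) : set (grass 1 V * grass 2 V) :=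
  range (fun c => val (mor_chamber f c)).

End Morphisms.
End Hermitian.

Arguments hermitian_form {F K} V sigma.

(** * Topologies *)

(* Coordinates of V over K, each expanded in coordinates of K over F. *)
Definition rcoords {R : realType} {F : fieldType} (a : absolute_value R F)
    {K : falgType F} {V : vectType K^c} (v : V) :
    'M[valued a]_(dim V, dim K) :=
  \matrix_(i, j) (v2r (v2r v 0 i : K) 0 j : valued a).

(* V, with the topology of a finite-dimensional F-vector space. *)
Definition vect_top {R : realType} {F : fieldType} (a : absolute_value R F)
    {K : falgType F} (V : vectType K^c) : topologicalType :=
  initial_topology (@rcoords R F a K V).

(* grass k V, with the topology induced by a. *)
Definition grass_top {R : realType} {F : fieldType} (a : absolute_value R F)
    {K : falgType F} (k : nat) (V : vectType K^c) : Type :=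
  grass k V.

Section GrassmannianTopology.
Context {R : realType} {F : fieldType} (a : absolute_value R F).
Context {K : falgType F} (k : nat) (V : vectType K^c).

Definition frames : set {ptws 'I_k -> vect_top a V} := @rfree F K V k.

Lemma frames_has_rdim (s : frames) : has_rdim k (@rspan F K V k (val s)).
Proof. by exists (val s) => //; exact: (set_mem (valP s)). Qed.

Definition grass_of (s : frames) : grass_top a k V :=
  Grass (frames_has_rdim s).

HB.instance Definition _ := gen_eqMixin (grass_top a k V).
HB.instance Definition _ := gen_choiceMixin (grass_top a k V).

(* Quotient topology of the space of frames. *)
Definition grass_open (O : set (grass_top a k V)) : Prop :=
  open (grass_of @^-1` O).

Lemma grass_openT : grass_open setT.
Proof. by rewrite /grass_open preimage_setT; exact: openT. Qed.

Lemma grass_openI : setI_closed grass_open.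
Proof. by move=> A B oA oB; exact: openI. Qed.

Lemma grass_open_bigU (I : Type) (f : I -> set (grass_top a k V)) :
  (forall i, grass_open (f i)) -> grass_open (\bigcup_i f i).
Proof. by move=> of_; apply: bigcup_open => i _; exact: of_. Qed.

HB.instance Definition _ := isOpenTopological.Build (grass_top a k V)
  grass_openT grass_openI grass_open_bigU.

End GrassmannianTopology.

Section MorphismTopology.
Context {R : realType} {F : fieldType} (a : absolute_value R F).
Context {K : falgType F} {V : vectType K^c} {sigma : K -> K}.
Context (phi : hermitian_form V sigma) (A : set (grass 1 V * grass 2 V)).

Definition chamber_top : topologicalType :=
  set_type (chamber phi : set (grass_top a 1 V * grass_top a 2 V)).

HB.instance Definition _ := gen_eqMixin (mor phi A).
HB.instance Definition _ := gen_choiceMixin (mor phi A).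

Definition mor_top : topologicalType :=
  initial_topology (@mor_chamber F K V sigma phi A :
    mor phi A -> {ptws A -> chamber_top}).

End MorphismTopology.

(* Main.v *)
Require Import Defs.
From mathcomp Require Import all_boot all_order all_algebra all_field.
From mathcomp Require Import all_classical all_reals all_analysis.

Set Implicit Arguments.
Unset Strict Implicit.
Unset Printing Implicit Defensive.

Import Order.TTheory GRing.Theory Num.Theory VectorInternalTheory.
Local Open Scope classical_set_scope.
Local Open Scope ring_scope.

(** The isotropic lines and the totally isotropic planes of V are the points and
    the lines of a generalized quadrangle: two points lie on a common line
    exactly when they are orthogonal, two distinct points lie on at most one
    common line, and Witt index 2 forbids triangles. A morphism of the octagon is
    a closed walk l0 p0 l1 p1 l2 p2 l3 p3 of length 8 in the incidence graph,
    and it is injective exactly when it runs once around an ordinary quadrangle.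
    As the graph has no shorter cycle, a walk that is not injective traverses a
    tree with at most four edges. The theorem says that all these walks are
    limits of quadrangles, unless the tree is a star with four branches.

    A first case is that two antipodal vertices of the walk are at distance 4.
    If p0 and p2 are not orthogonal, the walk is given by p0, p2 and two
    isotropic points p1, p3 of the orthogonal complement of p0 + p2, and it is
    a quadrangle as soon as p1 <> p3 (limit_quadrangle); in dimension at least 5
    no isotropic point of that complement is isolated (limit_opp_points). If
    l0 and l2 have zero intersection, moving a point along l0 and its unique
    neighbour along l2 leads back to that situation (limit_opp_lines).
    In the remaining trees that are not stars, every vertex is within distance 1
    of one edge {p, l}. Such a tree is a fork: either l carries one point besides
    p and p carries up to two lines besides l (limit_fork), or p carries one line
    besides l and l carries up to two points besides p (limit_cofork). Small
    deformations of a fork push two antipodal vertices to distance 4. Finally, a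
    walk around a star with at most three branches uses some branch twice, and
    moving a few of its vertices turns it into a fork or into a walk with an
    antipodal pair at distance 4 (limit_star_adjacent, limit_star_opposite and
    their duals limit_costar_adjacent and limit_costar_opposite). A closure is
    closed, so these deformations can be composed.

    All deformations are polynomial. A vector v is replaced by
    v + w1 t + w2 t^2, where t = eps^n for a scalar eps <> 0 of F with |eps| < 1
    and sigma(eps) = eps. Such a t is central and fixed by sigma, hence the
    orthogonality relations become polynomial identities in t, and the
    convergence only uses that addition and multiplication by scalars of F are
    continuous. An arbitrary t would not do: an involution of the field of
    complex numbers can be discontinuous, and then sigma(t) need not be small.
    The scalar eps exists because the absolute value cannot be trivial on the
    scalars fixed by sigma (exists_small_fixed_scalar). *)

(** * Sequences of vectors *)

Local Notation "v *> x" := (rscale v x) (at level 40, left associativity).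

Lemma cvg_initial (S : choiceType) (T : topologicalType) (f : S -> T)
    (I : Type) (G : set_system I) (u : I -> S) (s : S) :
  Filter G -> f (u i) @[i --> G] --> f s ->
  u i @[i --> G] --> (s : initial_topology f).
Proof.
move=> FG cv A [_ [[B Bop <-] Bfs] sBA].
have /cv : nbhs (f s) B by exact: open_nbhs_nbhs.
by apply: (@filterS _ G) => i /sBA.
Qed.

Lemma cvg_ptws (U : Type) (T : topologicalType) (I : Type) (G : set_system I)
    (u : I -> {ptws U -> T}) (s : {ptws U -> T}) :
  Filter G -> (forall x, u i x @[i --> G] --> s x) ->
  u i @[i --> G] --> s.
Proof.
move=> FG cv; apply/cvg_sup => x.
exact: (@cvg_initial {ptws U -> T} T (fun f => f x) I G u s).
Qed.

Section Powers.
Context {R : realType} {F : fieldType} (a : absolute_value R F).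
Context {K : falgType F} {V : vectType K^c}.

Lemma absv1 : a 1 = 1.
Proof.
have a10 : a 1 != 0 by apply/eqP => /absv_eq0/eqP; rewrite oner_eq0.
by apply: (mulfI a10); rewrite -absvM !mulr1.
Qed.

Lemma absvX x n : a (x ^+ n) = a x ^+ n.
Proof. by elim: n => [|n IH]; rewrite ?expr0 ?absv1 // !exprS absvM IH. Qed.

Lemma absvN x : a (- x) = a x.
Proof.
have aN1 : a (- 1) = 1.
  apply/eqP; rewrite -(@eqrXn2 _ 2) ?absv_ge0//.
  by rewrite expr2 -absvM mulrNN mulr1 absv1 expr1n.
by rewrite -mulN1r absvM aN1 mul1r.
Qed.

(** The three coefficients of a quadratic curve in t; every deformation of a
    vector below is of this form. *)
Definition perturb (v w1 w2 : V) (t : F) : V :=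
  v + rscale w1 t%:A + rscale w2 (t * t)%:A.

Lemma rcoords_perturb (v w1 w2 : V) t i j :
  rcoords a (perturb v w1 w2 t) i j =
  (rcoords a v i j : F) + t * (rcoords a w1 i j : F)
   + (t * t) * (rcoords a w2 i j : F) :> F.
Proof.
have E w s k : (v2r (v2r (rscale w s%:A) 0 i : K) 0 k : F) =
               s * v2r (v2r w 0 i : K) 0 k.
  rewrite linearZ mxE.
  have -> : ((s%:A : K^c) * v2r w 0 i) = (s *: (v2r w 0 i : K)) :> K.
    by rewrite -[LHS]/((v2r w 0 i : K) * s%:A) mulr_algr.
  by rewrite linearZ mxE.
by rewrite /rcoords /perturb !mxE !linearD !mxE !linearD !mxE !E.
Qed.

(** In coordinates over F the difference is t x + t^2 y, and |t^2 y| <= |t y|. *)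
Lemma cvg_perturb (eps : F) (v w1 w2 : V) : a eps < 1 ->
  perturb v w1 w2 (eps ^+ n) @[n --> \oo] --> (v : vect_top a V).
Proof.
move=> eps1; apply: (@cvg_initial _ _ (@rcoords R F a K V)).
move=> A [P nP sPA]; apply: (filterS sPA).
have H i j : \forall n \near \oo, P i j (rcoords a (perturb v w1 w2 (eps ^+ n)) i j).
  have /nbhs_ballP[r /= r0 sP] := nP i j.
  pose b : R := a (rcoords a w1 i j) + a (rcoords a w2 i j).
  have b0 : 0 <= b by rewrite addr_ge0// absv_ge0.
  have cvb : (a eps ^+ n * b : R^o) @[n --> \oo] --> (0 * b : R^o).
    by apply: cvgMl; apply: cvg_expr; rewrite ger0_norm ?absv_ge0.
  rewrite mul0r in cvb.
  have /cvgr0Pnorm_lt/(_ r r0) := cvb.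
  apply: filterS => n; rewrite ger0_norm ?mulr_ge0 ?exprn_ge0 ?absv_ge0// => lt.
  apply: sP.
  change (a ((rcoords a v i j : F) -
             (rcoords a (perturb v w1 w2 (eps ^+ n)) i j : F)) < r).
  rewrite rcoords_perturb -!addrA opprD addNKr absvN.
  apply: le_lt_trans lt; apply: (le_trans (absvD _ _ _)).
  rewrite !absvM absvX mulrDr lerD2l; apply: ler_wpM2r; rewrite ?absv_ge0//.
  by rewrite ler_piMl ?exprn_ge0 ?absv_ge0// exprn_ile1 ?absv_ge0// ltW.
have : \forall n \near \oo, forall ij : 'I_(dim V) * 'I_(dim K),
    P ij.1 ij.2 (rcoords a (perturb v w1 w2 (eps ^+ n)) ij.1 ij.2).
  by apply: filter_forall => -[i j]; exact: H.
by apply: filterS => n Hn i j; exact: (Hn (i, j)).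
Qed.

End Powers.

(** * Morphisms of an apartment as closed walks *)

Section Circuits.
Context {R : realType} {F : fieldType} (a : absolute_value R F).
Context {K : falgType F} {V : vectType K^c} {sigma : K -> K}.
Context (phi : hermitian_form V sigma).

Definition isotropic_dim k (U : set V) := has_rdim k U /\ totally_isotropic phi U.

Definition circuit (p l : 'I_4 -> set V) := forall i,
  [/\ isotropic_dim 1 (p i), isotropic_dim 2 (l i), p i `<=` l i
    & p i `<=` l (ordS i)].

(** Convergence of subspaces, witnessed by frames that converge; this is what the
    quotient topology of the Grassmannian sees. *)
Definition span_cvg k (U : nat -> set V) (U0 : set V) :=
  exists (s : nat -> 'I_k -> V) (s0 : 'I_k -> V),
  [/\ forall n, rfree (s n) /\ U n = rspan (s n), rfree s0, U0 = rspan s0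
    & forall i, s n i @[n --> \oo] --> (s0 i : vect_top a V)].

(** The least set of circuits that contains the quadrangles and the limits of
    its sequences: limits of limits are allowed because a closure is closed. *)
Inductive limit_circuit : ('I_4 -> set V) -> ('I_4 -> set V) -> Prop :=
| limit_circuit_inj p l : circuit p l -> injective p -> injective l ->
    limit_circuit p l
| limit_circuit_lim (p l : nat -> 'I_4 -> set V) p0 l0 :
    (forall n, limit_circuit (p n) (l n)) -> circuit p0 l0 ->
    (forall i, span_cvg 1 (p^~ i) (p0 i)) -> (forall i, span_cvg 2 (l^~ i) (l0 i)) ->
    limit_circuit p0 l0.

Lemma circuit_of_limit p l : limit_circuit p l -> circuit p l.
Proof. by case. Qed.

Lemma gset_inj k : injective (@gset F K k V).
Proof.
move=> [G dG] [H dH] /= E; subst H.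
by congr Grass; exact: Prop_irrelevance.
Qed.

(** The map from frames to subspaces is continuous for the quotient topology. *)
Lemma span_cvg_grass k (U : nat -> grass k V) (U0 : grass k V) :
  span_cvg k (fun n => gset (U n)) U0 -> U n @[n --> \oo] --> (U0 : grass_top a k V).
Proof.
move=> [s [s0 [sP fs0 U0s0 cv]]].
pose S n : @frames R F a K k V := SigSub (mem_set (sP n).1).
pose S0 : @frames R F a K k V := SigSub (mem_set fs0).
have cS : S n @[n --> \oo] --> S0.
  by apply: cvg_initial; apply: cvg_ptws => i; exact: cv.
have -> : U = (fun n => grass_of (S n)).
  by apply/funext => n; apply: gset_inj; rewrite (sP n).2.
have -> : U0 = grass_of S0 by apply: gset_inj; rewrite U0s0.
have cont : continuous (@grass_of R F a K k V).
  by apply/continuousP => O; rewrite /open/= /grass_open.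
exact: (cvg_comp _ _ cS (cont S0)).
Qed.

Section Apartment.
Variable A : set (grass 1 V * grass 2 V).
Variables (L : 'I_4 -> grass 1 V) (P : 'I_4 -> grass 2 V).
Hypotheses (Linj : injective L) (Pinj : injective P).
Hypothesis AE : A = range (fun i => (L i, P i)) `|` range (fun i => (L i, P (ordS i))).

Lemma lineA_subproof i : (fst @` A) (L i).
Proof. by exists (L i, P i) => //; rewrite AE; left; exists i. Qed.
Lemma planeA_subproof i : (snd @` A) (P i).
Proof. by exists (L i, P i) => //; rewrite AE; left; exists i. Qed.

Definition lineA i : fst @` A := SigSub (mem_set (lineA_subproof i)).
Definition planeA i : snd @` A := SigSub (mem_set (planeA_subproof i)).

Lemma apartmentP c : A c -> exists i, c = (L i, P i) \/ c = (L i, P (ordS i)).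
Proof. by rewrite AE => -[] [i _ <-]; exists i; [left|right]. Qed.

Lemma lineA_surj (x : fst @` A) : exists i, x = lineA i.
Proof.
have [c /apartmentP[i ci] E] := set_mem (valP x).
by exists i; apply/val_inj; rewrite /= -E; case: ci => ->.
Qed.

Lemma planeA_surj (x : snd @` A) : exists i, x = planeA i.
Proof.
have [c /apartmentP[i [] ci] E] := set_mem (valP x);
  [exists i|exists (ordS i)]; by apply/val_inj; rewrite /= -E ci.
Qed.

Definition line_index x := projT1 (cid (lineA_surj x)).
Definition plane_index x := projT1 (cid (planeA_surj x)).

Lemma line_indexK x : lineA (line_index x) = x.
Proof. by rewrite -(projT2 (cid (lineA_surj x))). Qed.
Lemma plane_indexK x : planeA (plane_index x) = x.
Proof. by rewrite -(projT2 (cid (planeA_surj x))). Qed.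
Lemma lineAK i : line_index (lineA i) = i.
Proof. by apply: Linj; have /(congr1 val) := line_indexK (lineA i). Qed.
Lemma planeAK i : plane_index (planeA i) = i.
Proof. by apply: Pinj; have /(congr1 val) := plane_indexK (planeA i). Qed.

Lemma edgeA (c : A) : exists i, line_of c = lineA i /\
  (plane_of c = planeA i \/ plane_of c = planeA (ordS i)).
Proof.
have [i [] E] := apartmentP (set_mem (valP c)); exists i.
  by split; [|left]; apply/val_inj; rewrite /= E.
by split; [|right]; apply/val_inj; rewrite /= E.
Qed.

Section OfCircuit.
Variables (p l : 'I_4 -> set V).
Hypothesis pl : circuit p l.

Lemma circuit_line i : isotropic_dim 1 (p i). Proof. by have [] := pl i. Qed.
Lemma circuit_plane i : isotropic_dim 2 (l i). Proof. by have [] := pl i. Qed.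

Definition circuit_isoline i : isoline phi :=
  SigSub (@mem_set _ (isoline phi) (Grass (circuit_line i).1) (circuit_line i).2).
Definition circuit_isoplane i : isoplane phi :=
  SigSub (@mem_set _ (isoplane phi) (Grass (circuit_plane i).1) (circuit_plane i).2).

Lemma mor_of_circuit_subproof (c : A) :
  (val (circuit_isoline (line_index (line_of c))) : set V) `<=`
  val (circuit_isoplane (plane_index (plane_of c))).
Proof.
have [i [-> [] ->]] := edgeA c; rewrite lineAK planeAK /=;
by have [] := pl i.
Qed.

Definition mor_of_circuit : mor phi A :=
  @Mor F K V sigma phi A (fun x => circuit_isoline (line_index x))
    (fun x => circuit_isoplane (plane_index x)) mor_of_circuit_subproof.

End OfCircuit.

Definition line_images (f : mor phi A) i : set V := gset (val (mor_line f (lineA i))).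
Definition plane_images (f : mor phi A) i : set V := gset (val (mor_plane f (planeA i))).

Lemma circuit_images f : circuit (line_images f) (plane_images f).
Proof.
move=> i; rewrite /line_images /plane_images; split.
- split; first exact: grass_dim.
  exact: (set_mem (valP (mor_line f (lineA i)))).
- split; first exact: grass_dim.
  exact: (set_mem (valP (mor_plane f (planeA i)))).
- have cA : A (L i, P i) by rewrite AE; left; exists i.
  pose c : A := SigSub (mem_set cA).
  have <- : line_of c = lineA i by exact/val_inj.
  have <- : plane_of c = planeA i by exact/val_inj.
  exact: mor_incident.
- have cA : A (L i, P (ordS i)) by rewrite AE; right; exists i.
  pose c : A := SigSub (mem_set cA).
  have <- : line_of c = lineA i by exact/val_inj.
  have <- : plane_of c = planeA (ordS i) by exact/val_inj.
  exact: mor_incident.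
Qed.

Lemma mor_cvg (g : nat -> mor phi A) (f : mor phi A) :
  (forall i, span_cvg 1 (fun n => line_images (g n) i) (line_images f i)) ->
  (forall i, span_cvg 2 (fun n => plane_images (g n) i) (plane_images f i)) ->
  g n @[n --> \oo] --> (f : mor_top a phi A).
Proof.
move=> cl cp; apply: cvg_initial; apply: cvg_ptws => c.
apply: (@cvg_initial _ (grass_top a 1 V * grass_top a 2 V)%type
  (set_val : chamber_top a phi -> grass_top a 1 V * grass_top a 2 V)).
have cl' := span_cvg_grass (U0 := val (mor_line f (line_of c))) (U := fun n => val (mor_line (g n) (line_of c))).
have cp' := span_cvg_grass (U0 := val (mor_plane f (plane_of c))) (U := fun n => val (mor_plane (g n) (plane_of c))).
apply: (cvg_pair (cl' _) (cp' _)).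
  by have := cl (line_index (line_of c)); rewrite /line_images line_indexK.
by have := cp (plane_index (plane_of c)); rewrite /plane_images plane_indexK.
Qed.

(** Each circuit of a derivation of limit_circuit is the circuit of a morphism,
    and convergence of circuits is convergence of morphisms; so the derivation
    is followed step by step inside the closure, which is sequentially closed. *)
Lemma limit_circuit_closure p l : limit_circuit p l ->
  forall f, p = line_images f -> l = plane_images f ->
    @closure (mor_top a phi A) (mor_inj (phi := phi) (A := A)) f.
Proof.
elim=> {p l} [p l _ pinj linj f pE lE|p l p0 l0 pl IH c0 cp cl f pE lE].
  apply: subset_closure; split => x y E.
    have /pinj : p (line_index x) = p (line_index y).
      by rewrite pE /line_images !line_indexK E.
    by move=> E'; rewrite -(line_indexK x) E' line_indexK.
  have /linj : l (plane_index x) = l (plane_index y).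
    by rewrite lE /plane_images !plane_indexK E.
  by move=> E'; rewrite -(plane_indexK x) E' plane_indexK.
pose g n := mor_of_circuit (circuit_of_limit (pl n)).
have gl n : p n = line_images (g n).
  by apply/funext => i; rewrite /line_images /= lineAK.
have gp n : l n = plane_images (g n).
  by apply/funext => i; rewrite /plane_images /= planeAK.
have gf : g n @[n --> \oo] --> (f : mor_top a phi A).
  apply: mor_cvg => i.
    by have := cp i; rewrite pE; congr span_cvg; apply/funext => n; rewrite gl.
  by have := cl i; rewrite lE; congr span_cvg; apply/funext => n; rewrite gp.
have clo n : @closure (mor_top a phi A) (mor_inj (phi := phi) (A := A)) (g n).
  exact: IH (gl n) (gp n).
apply: (@closed_cvg _ (mor_top a phi A) \oo _ g _ (@closed_closure _ _) _ f gf).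
exact: nearW.
Qed.

End Apartment.
End Circuits.

(** * Morphisms whose image is a quadripod *)

Section Quadripods.
Context {F : fieldType} {K : falgType F} {V : vectType K^c} {sigma : K -> K}.
Context (phi : hermitian_form V sigma).
Variable A : set (grass 1 V * grass 2 V).
Variables (L : 'I_4 -> grass 1 V) (P : 'I_4 -> grass 2 V).
Hypothesis AE : A = range (fun i => (L i, P i)) `|` range (fun i => (L i, P (ordS i))).
Variable f : mor phi A.

Let p i := val (mor_line f (lineA AE i)).
Let l i := val (mor_plane f (planeA AE i)).

Lemma mor_image_edges :
  mor_image f = range (fun i => (p i, l i)) `|` range (fun i => (p i, l (ordS i))).
Proof.
rewrite eqEsubset; split => e.
  move=> [c _ <-]; have [i [El [Ep|Ep]]] := edgeA AE c; [left|right]; exists i => //;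
  by rewrite /= El Ep.
have edge i j : A (L i, P j) -> mor_image f (p i, l j).
  move=> cA; exists (SigSub (mem_set cA)) => //=.
  by congr (val (mor_line f _), val (mor_plane f _)); exact/val_inj.
by case=> -[i _ <-]; apply: edge; rewrite AE; [left|right]; exists i.
Qed.

Lemma chamber_image e : mor_image f e -> chamber phi e.
Proof. by move=> [c _ <-]; exact: mor_chamber_subproof. Qed.

Lemma quadripod_around_line : (forall i j, p i = p j) -> injective l ->
  quadripod phi (mor_image f).
Proof.
move=> pE linj; exists (fun i => (p i, l i)).
have QE : mor_image f = range (fun i => (p i, l i)).
  rewrite mor_image_edges eqEsubset; split => e; last by left.
  by case=> // -[i _ <-]; exists (ordS i) => //; rewrite (pE i (ordS i)).
split=> //; first by move=> i j [_ /linj].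
  by move=> i; apply: chamber_image; rewrite QE; exists i.
exists (inl (p 0)); rewrite eqEsubset; split => x.
  move=> H; have [//|x0] := H 0 I; have [x1|x1] := H 1 I.
    by rewrite x1 in x0.
  by have [/linj] : inr (l 0) = inr (l 1) :> (grass 1 V + grass 2 V) by rewrite -x0 -x1.
by move=> -> i _; left; rewrite /= (pE 0 i).
Qed.

Lemma quadripod_inside_plane : (forall i j, l i = l j) -> injective p ->
  quadripod phi (mor_image f).
Proof.
move=> lE pinj; exists (fun i => (p i, l i)).
have QE : mor_image f = range (fun i => (p i, l i)).
  rewrite mor_image_edges eqEsubset; split => e; last by left.
  by case=> // -[i _ <-]; exists i => //; rewrite (lE i (ordS i)).
split=> //; first by move=> i j [/pinj].
  by move=> i; apply: chamber_image; rewrite QE; exists i.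
exists (inr (l 0)); rewrite eqEsubset; split => x.
  move=> H; have [x0|//] := H 0 I; have [x1|x1] := H 1 I; last by rewrite x0 in x1.
  by have [/pinj] : inl (p 0) = inl (p 1) :> (grass 1 V + grass 2 V) by rewrite -x0 -x1.
by move=> -> i _; right; rewrite /= (lE 0 i).
Qed.

End Quadripods.

(** * Linear algebra over a division ring *)

Section RightLinearAlgebra.
Context {F : fieldType} {K : falgType F} {V : vectType K^c}.
Implicit Types (u v w : V) (x y z : K).

Lemma rscaleDl u v x : (u + v) *> x = u *> x + v *> x.
Proof. exact: scalerDr. Qed.
Lemma rscaleDr u x y : u *> (x + y) = u *> x + u *> y.
Proof. exact: (scalerDl u (x : K^c) (y : K^c)). Qed.
Lemma rscaleA u x y : u *> x *> y = u *> (x * y).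
Proof. exact: (scalerA (y : K^c) (x : K^c) u). Qed.
Lemma rscale1 u : u *> 1 = u. Proof. exact: scale1r. Qed.
Lemma rscale0 u : u *> 0 = 0. Proof. exact: scale0r. Qed.
Lemma rscale0l x : (0 : V) *> x = 0. Proof. exact: scaler0. Qed.
Lemma rscaleN u x : u *> (- x) = - (u *> x).
Proof. exact: (scaleNr (x : K^c) u). Qed.
Lemma rscaleNl u x : (- u) *> x = - (u *> x). Proof. exact: scalerN. Qed.
Lemma rscale_suml (I : Type) (r : seq I) (P : pred I) (f : I -> V) x :
  (\sum_(i <- r | P i) f i) *> x = \sum_(i <- r | P i) f i *> x.
Proof. exact: scaler_sumr. Qed.
Lemma rscale_sumr (I : Type) (r : seq I) (P : pred I) (f : I -> K) u :
  u *> (\sum_(i <- r | P i) f i) = \sum_(i <- r | P i) u *> f i.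
Proof. exact: (@scaler_suml K^c V u I r P f). Qed.

Definition ray u : set V := [set v | exists x, v = u *> x].
Definition plane u v : set V := [set w | exists x y, w = u *> x + v *> y].
Definition indep u v : Prop :=
  forall x y, u *> x + v *> y = 0 -> x = 0 /\ y = 0.

Definition vec1 u : 'I_1 -> V := fun=> u.
Definition vec2 u v : 'I_2 -> V := fun i => if i == 0 then u else v.

Lemma rspan_vec1 u : rspan (vec1 u) = ray u.
Proof.
rewrite eqEsubset; split => w.
  by move=> [c _ <-]; exists (c 0); rewrite /rcomb big_ord1.
by move=> [x ->]; exists (fun=> x) => //; rewrite /rcomb big_ord1.
Qed.

Lemma rcomb_vec2 u v c : rcomb (vec2 u v) c = u *> c 0 + v *> c 1.
Proof. by rewrite /rcomb big_ord_recl big_ord1; congr (_ + _ *> c _); apply/val_inj. Qed.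

Lemma rspan_vec2 u v : rspan (vec2 u v) = plane u v.
Proof.
rewrite eqEsubset; split => w.
  by move=> [c _ <-]; exists (c 0), (c 1); rewrite rcomb_vec2.
move=> [x [y ->]]; exists (fun i => if i == 0 then x else y) => //.
by rewrite rcomb_vec2.
Qed.

Lemma rfree_vec2 u v : indep u v -> rfree (vec2 u v).
Proof.
move=> uv c; rewrite rcomb_vec2 => /uv [c0 c1] [[|[|//]] ilt].
  by rewrite -c0; congr c; apply/val_inj.
by rewrite -c1; congr c; apply/val_inj.
Qed.

Lemma rspan_subspace k (s : 'I_k -> V) : rsubspace (rspan s).
Proof.
split; first by exists (fun=> 0) => //; rewrite /rcomb big1 // => i _; rewrite rscale0.
move=> _ _ x [c _ <-] [d _ <-]; exists (fun i => c i + d i * x) => //.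
rewrite /rcomb rscale_suml -big_split; apply: eq_bigr => i _.
by rewrite /= rscaleDr rscaleA.
Qed.

Hypothesis Kdiv : division_algebra K.

Lemma mulKx x y : x != 0 -> x^-1 * (x * y) = y.
Proof. by move=> /Kdiv xu; rewrite mulrA mulVr // mul1r. Qed.

Lemma mulxV x : x != 0 -> x * x^-1 = 1.
Proof. by move=> /Kdiv xu; rewrite divrr. Qed.

Lemma mulVx x : x != 0 -> x^-1 * x = 1.
Proof. by move=> /Kdiv xu; rewrite mulVr. Qed.

Lemma mulf0 x y : x * y = 0 -> x != 0 -> y = 0.
Proof. by move=> xy x0; rewrite -(mulKx y x0) xy mulr0. Qed.

Lemma invx0 x : x != 0 -> x^-1 != 0.
Proof. by move=> x0; rewrite invr_eq0. Qed.

Lemma rscale_eq0 u x : u *> x = 0 -> u != 0 -> x = 0.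
Proof.
move=> ux u0; apply/eqP; apply: contraNT u0 => /mulxV xV.
by rewrite -[u]rscale1 -xV -rscaleA ux rscale0l.
Qed.

Lemma rfree_vec1 u : u != 0 -> rfree (vec1 u).
Proof.
move=> u0 c; rewrite /rcomb big_ord1 /= => E i.
by rewrite [i]ord1; apply: rscale_eq0 E u0.
Qed.

(** Gaussian elimination: a pivot in the first equation expresses one unknown
    through the others. *)
Lemma nontrivial_solution m (M : 'I_m -> 'I_m.+1 -> K) :
  exists2 c : 'I_m.+1 -> K, (exists j, c j != 0)
    & forall i, \sum_j M i j * c j = 0.
Proof.
elim: m M => [|m IH] M.
  by exists (fun=> 1) => [|[]//]; exists 0; rewrite oner_eq0.
(* If the first equation is zero, any unknown can be eliminated: its
   coefficient 0 has inverse 0. *)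
have [j0 j0P] : exists j0, M ord0 j0 != 0 \/ forall j, M ord0 j = 0.
  have [[j Mj]|H] := pselect (exists j, M ord0 j != 0); first by exists j; left.
  exists 0; right=> j; apply/eqP/negPn/negP => Mj; apply: H; by exists j.
pose N i j := M (lift ord0 i) (lift j0 j) -
  M (lift ord0 i) j0 * (M ord0 j0)^-1 * M ord0 (lift j0 j).
have [d [j dj] dN] := IH N.
pose z := \sum_j M ord0 (lift j0 j) * d j.
pose c k := if unlift j0 k is Some k' then d k' else - (M ord0 j0)^-1 * z.
have cj0 : c j0 = - (M ord0 j0)^-1 * z by rewrite /c unlift_none.
have cl k : c (lift j0 k) = d k by rewrite /c liftK.
exists c; first by exists (lift j0 j); rewrite cl.
move=> i; rewrite (bigD1_ord j0) //= cj0.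
under eq_bigr do rewrite cl.
case: (unliftP ord0 i) => [k ->|->].
  have E : \sum_j M (lift ord0 k) (lift j0 j) * d j =
           M (lift ord0 k) j0 * (M ord0 j0)^-1 * z.
    apply/eqP; rewrite -subr_eq0 /z mulr_sumr -sumrB -[X in _ == X](dN k).
    by apply/eqP/eq_bigr => l _; rewrite /N mulrBl !mulrA.
  by rewrite E mulNr mulrN mulrA addNr.
case: j0P => [M0|M0]; last first.
  by rewrite M0 mul0r add0r big1 // => l _; rewrite M0 mul0r.
by rewrite -/z mulNr mulrN mulrA mulxV // mul1r addNr.
Qed.

Lemma span_dependent k (s : 'I_k -> V) (w : 'I_k.+1 -> V) :
  (forall j, rspan s (w j)) ->
  exists2 c : 'I_k.+1 -> K, (exists j, c j != 0) & rcomb w c = 0.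
Proof.
move=> sw.
have /choice[M ME] : forall j, exists d, w j = rcomb s d.
  by move=> j; have [d _ <-] := sw j; exists d.
have [c c0 cM] := nontrivial_solution (fun i j => M j i).
exists c => //; rewrite /rcomb.
under eq_bigr do rewrite ME /rcomb rscale_suml.
rewrite exchange_big big1 // => i _.
under eq_bigr do rewrite rscaleA.
by rewrite -rscale_sumr cM rscale0.
Qed.

Lemma exists_not_in_span k (s : 'I_k -> V) : (k < dim V)%N ->
  exists v, ~ rspan s v.
Proof.
move=> kV; apply: contrapT => H.
have sT v : rspan s v by apply: contrapT => sv; apply: H; exists v.
pose b (j : 'I_k.+1) : V := r2v (delta_mx 0 (widen_ord kV j)).
have [c [j cj]] := span_dependent (fun j => sT (b j)).
move/(congr1 v2r)/(congr1 (fun M : 'rV_(dim V) => M 0 (widen_ord kV j))).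
rewrite linear0 mxE /rcomb linear_sum summxE (bigD1 j) //= big1 ?addr0.
  rewrite linearZ mxE /= /b r2vK mxE !eqxx /= => E.
  case/negP: cj; apply/eqP; rewrite -E; exact: (esym (mul1r (c j))).
move=> i ij; rewrite linearZ mxE /= /b r2vK mxE eqxx /=.
have -> : (widen_ord kV j == widen_ord kV i) = false.
  by apply/negbTE; apply: contra ij => /eqP/(congr1 val)/= /val_inj ->.
exact: (mul0r (c i)).
Qed.

Lemma plane_basis l u v : has_rdim 2 l -> l u -> l v -> indep u v -> l = plane u v.
Proof.
move=> [s _ ->] su sv uv; rewrite eqEsubset; split => w; last first.
  move=> [x [y ->]]; have [s0 sD] := rspan_subspace s.
  by have := sD _ _ y (sD _ _ x s0 su) sv; rewrite add0r.
move=> sw.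
pose t (j : 'I_3) := if j == 0 then u else if j == 1 then v else w.
have st j : rspan s (t j) by rewrite /t; case: eqP => // _; case: eqP.
have [c [j cj]] := span_dependent st.
rewrite /rcomb !big_ord_recl big_ord0 addr0 addrA /t /=.
set c0 := c _; set c1 := c _; set c2 := c _ => E.
have [c20|c20] := eqVneq c2 0.
  move: E; rewrite c20 rscale0 addr0 => /uv[c00 c10]; case/negP: cj.
  have : [|| j == ord0, j == lift ord0 ord0 | j == lift ord0 (lift ord0 ord0)].
    by case: j => -[|[|[|]]].
  by case/or3P => /eqP ->; apply/eqP.
exists (- (c0 * c2^-1)), (- (c1 * c2^-1)).
have Ew : w = w *> c2 *> c2^-1 by rewrite rscaleA mulxV // rscale1.
rewrite !rscaleN -opprD; apply/eqP; rewrite -addr_eq0 addrC [X in _ + X]Ew.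
by rewrite -!(rscaleA _ _ c2^-1) -!rscaleDl E rscale0l.
Qed.

Lemma indep_ray u v : u != 0 -> ~ ray u v -> indep u v.
Proof.
move=> u0 uv x y E.
have y0 : y = 0.
  apply/eqP/negPn/negP => y0; apply: uv; exists (- (x * y^-1)).
  rewrite rscaleN -rscaleA; apply/eqP; rewrite -addr_eq0 addrC.
  by rewrite -[v]rscale1 -(mulxV y0) -(rscaleA v) -rscaleDl E rscale0l eqxx.
split=> //; move: E; rewrite y0 rscale0 addr0 => E; exact: rscale_eq0 E u0.
Qed.

(** Otherwise the two vectors of a frame of l would be multiples of u. *)
Lemma plane_extend l u : has_rdim 2 l -> l u -> u != 0 ->
  exists v, [/\ l v, indep u v & l = plane u v].
Proof.
move=> l2 lu u0; suff [v lv uv] : exists2 v, l v & ~ ray u v.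
  by have iuv := indep_ray u0 uv; exists v; split=> //; apply: plane_basis.
apply: contrapT => H; have {H}lr v : l v -> ray u v.
  by move=> lv; apply: contrapT => ruv; apply: H; exists v.
case: l2 => s fs ls.
have us i : rspan (vec1 u) (s i).
  rewrite rspan_vec1; apply: lr; rewrite ls.
  exists (fun j => (j == i)%:R) => //; rewrite /rcomb (bigD1 i) //= eqxx rscale1.
  by rewrite big1 ?addr0 // => j /negbTE ->; rewrite rscale0.
have [c [j cj] /fs/(_ j) E] := span_dependent us.
by rewrite E eqxx in cj.
Qed.

Lemma ray_eq u v : u != 0 -> v != 0 -> ray u v -> ray u = ray v.
Proof.
move=> u0 v0 [x E].
have x0 : x != 0 by apply: contraNneq v0 => x0; rewrite E x0 rscale0.
rewrite eqEsubset; split => w [y ->].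
  by exists (x^-1 * y); rewrite E rscaleA mulrA mulxV // mul1r.
by exists (x * y); rewrite E rscaleA.
Qed.

End RightLinearAlgebra.

(** * Hyperbolic frames *)

Section HermitianGeometry.
Context {F : fieldType} {K : falgType F} {V : vectType K^c} {sigma : K -> K}.
Implicit Types (u v w e f g : V) (x y z : K).
Hypothesis Kdiv : division_algebra K.
Hypothesis char2 : 2%N \notin [pchar F].
Hypothesis sigmaD : {morph sigma : x y / x + y}.
Hypothesis sigmaM : forall x y, sigma (x * y) = sigma y * sigma x.
Hypothesis sigmaK : involutive sigma.
Context (phi : hermitian_form V sigma).

Lemma sigma0 : sigma 0 = 0.
Proof. by apply: (addrI (sigma 0)); rewrite -sigmaD !addr0. Qed.
Lemma sigma1 : sigma 1 = 1.
Proof. by have := sigmaM (sigma 1) 1; rewrite mulr1 sigmaK mulr1 => <-. Qed.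
Lemma sigmaN x : sigma (- x) = - sigma x.
Proof. by apply/eqP; rewrite -addr_eq0 -sigmaD addNr sigma0. Qed.

Lemma hformZl v w x : phi (v *> x) w = sigma x * phi v w.
Proof. by have := hformZ phi v w x 1; rewrite rscale1 mulr1. Qed.
Lemma hformZr v w x : phi v (w *> x) = phi v w * x.
Proof. by have := hformZ phi v w 1 x; rewrite rscale1 sigma1 mul1r. Qed.
Lemma hform0l w : phi 0 w = 0.
Proof. by rewrite -(rscale0 w) hformZl sigma0 mul0r. Qed.
Lemma hform0r w : phi w 0 = 0.
Proof. by rewrite -(rscale0 w) hformZr mulr0. Qed.
Lemma hformNl v w : phi (- v) w = - phi v w.
Proof. by rewrite -[- v]rscale1 rscaleNl -rscaleN hformZl sigmaN sigma1 mulN1r. Qed.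
Lemma hformNr v w : phi v (- w) = - phi v w.
Proof. by rewrite -[- w]rscale1 rscaleNl -rscaleN hformZr mulrN1. Qed.

Notation simp0 := (hform0l, hform0r, mul0r, mulr0, scaler0, addr0, add0r).

Definition hformE := (hformDl phi, hformDr phi, hformZl, hformZr, hformNl, hformNr).

Lemma hform_comb w u v x y : phi w (u *> x + v *> y) = phi w u * x + phi w v * y.
Proof. by rewrite hformDr !hformZr. Qed.

Lemma hform_eq0 v w : phi v w = 0 -> phi w v = 0.
Proof. by move=> E; rewrite hform_sym E sigma0. Qed.
Lemma hform_eq1 v w : phi v w = 1 -> phi w v = 1.
Proof. by move=> E; rewrite hform_sym E sigma1. Qed.

Lemma two_neq0 : (2%:R : F) != 0.
Proof. by apply: contra char2 => E; rewrite inE. Qed.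

Lemma halfD x : 2%:R^-1 *: x + 2%:R^-1 *: x = x.
Proof. by rewrite -scalerDl -mulr2n -(mulr_natr (2%:R^-1) 2) mulVf ?two_neq0 // scale1r. Qed.

(** The element y = sigma(x/2) satisfies y + y = x, and 2 is invertible. *)
Lemma sigma_half x : sigma x = x -> sigma (2%:R^-1 *: x) = 2%:R^-1 *: x.
Proof.
move=> sx; have := halfD x => /(congr1 sigma); rewrite sigmaD sx.
rewrite -[X in _ = X -> _](halfD x) -!mulr2n -!scaler_nat => E.
have : (2%:R : F) *: (sigma (2^-1 *: x) - 2^-1 *: x) = 0.
  by rewrite scalerBr !scaler_nat -!scaler_nat E subrr.
by move/eqP; rewrite scaler_eq0 (negbTE two_neq0) subr_eq0 => /eqP.
Qed.

(** If e is isotropic and phi e f = 1, subtracting e x from f changes phi f f by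
    - x - sigma x; as phi f f is fixed by sigma, half of it is a suitable x. *)
Definition isotropize e f := f - e *> (2%:R^-1 *: phi f f).

Lemma isotropizeP e f : phi e e = 0 -> phi e f = 1 ->
  phi (isotropize e f) (isotropize e f) = 0.
Proof.
move=> ee ef; have fe := hform_eq1 ef.
rewrite /isotropize !hformE ee ef fe sigma_half -?hform_sym //.
rewrite !(mul1r, mulr1, mulr0, mul0r, subr0).
by rewrite -[X in X - _ + _](halfD (phi f f)) addrK oppr0 mulr0 subr0 subrr.
Qed.

Lemma hform_isotropize e f w : phi w e = 0 -> phi w (isotropize e f) = phi w f.
Proof. by move=> we; rewrite /isotropize !hformE we mul0r oppr0 addr0. Qed.

Hypothesis phi_nondeg : nondegenerate_form phi.

(** If every f orthogonal to e2 were orthogonal to e1, the functionals phi e1 and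
    phi e2 would be proportional, and so would e1 and e2 by nondegeneracy. *)
Lemma exists_dual e1 e2 : indep e1 e2 -> exists f, phi e1 f = 1 /\ phi e2 f = 0.
Proof.
move=> ie; have e20 : e2 != 0.
  apply/eqP => e20; have [_ /eqP] : (0 : K) = 0 /\ (1 : K) = 0.
    by apply: ie; rewrite e20 rscale0 rscale0l addr0.
  by rewrite oner_eq0.
have [g ge2] : exists g, phi e2 g = 1.
  apply: contrapT => H; case/eqP: e20; apply: phi_nondeg => w.
  apply/eqP/negPn/negP => w0; apply: H; exists (w *> (phi e2 w)^-1).
  by rewrite hformZr mulxV.
have [f fe2 fe1] : exists2 f, phi e2 f = 0 & phi e1 f != 0.
  apply: contrapT => H.
  have {}H f : phi e2 f = 0 -> phi e1 f = 0.
    by move=> E; apply/eqP/negPn/negP => f0; apply: H; exists f.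
  have : e1 *> 1 + e2 *> (- sigma (phi e1 g)) = 0.
    apply: phi_nondeg => w; rewrite !hformE sigma1 mul1r sigmaN sigmaK mulNr.
    have := H (w - g *> phi e2 w); rewrite !hformE ge2 mul1r subrr => /(_ erefl).
    by [].
  by move/ie => [/eqP]; rewrite oner_eq0.
exists (f *> (phi e1 f)^-1).
by rewrite !hformZr fe2 mul0r mulxV.
Qed.

Lemma isotropic_dual e1 e2 : indep e1 e2 -> phi e1 e1 = 0 -> phi e1 e2 = 0 ->
  exists f1, [/\ phi e1 f1 = 1, phi e2 f1 = 0 & phi f1 f1 = 0].
Proof.
move=> ie e11 e12; have [f [e1f e2f]] := exists_dual ie.
have e21 := hform_eq0 e12.
by exists (isotropize e1 f); rewrite isotropizeP // !hform_isotropize.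
Qed.

(** The component of a dual vector along f2 is removed by a multiple of e2, which
    is orthogonal to e1 and e2. *)
Lemma isotropic_dual_perp e1 e2 f2 : indep e1 e2 ->
    phi e1 e1 = 0 -> phi e1 e2 = 0 -> phi e2 e2 = 0 ->
    phi e1 f2 = 0 -> phi e2 f2 = 1 ->
  exists f1, [/\ phi e1 f1 = 1, phi e2 f1 = 0, phi f1 f1 = 0 & phi f1 f2 = 0].
Proof.
move=> ie e11 e12 e22 e1f2 e2f2; have [f [e1f e2f]] := exists_dual ie.
pose f' := f - e2 *> phi f2 f.
have e1f' : phi e1 f' = 1 by rewrite /f' !hformE e12 mul0r subr0.
have e2f' : phi e2 f' = 0 by rewrite /f' !hformE e22 mul0r subr0.
have f2f' : phi f2 f' = 0 by rewrite /f' !hformE (hform_eq1 e2f2) mul1r subrr.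
have e21 := hform_eq0 e12; have f2e1 := hform_eq0 e1f2.
exists (isotropize e1 f'); rewrite isotropizeP // !hform_isotropize //.
by split=> //; apply: hform_eq0; rewrite hform_isotropize.
Qed.

Hypothesis phi_witt : witt_index phi 2.

(** Zorn's lemma provides the maximal totally isotropic subspace to which the
    Witt index refers; set0 is only there to bound the empty chain. *)
Lemma isotropic_subset_plane (U : set V) : rsubspace U -> totally_isotropic phi U ->
  exists2 M : set V, has_rdim 2 M & U `<=` M.
Proof.
move=> U0 Ui.
pose good (W : set V) := [/\ rsubspace W, totally_isotropic phi W & U `<=` W].
have [|M [MU Mmax]] := @Zorn_bigcup V (fun W => W = set0 \/ good W).
  move=> C CP Ctot; have [[W CW Wg]|H] := pselect (exists2 W, C W & good W); last first.
    left; rewrite -subset0 => w [W CW Ww].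
    have [W0|Wg] := CP _ CW; first by rewrite W0 in Ww.
    by apply: H; exists W.
  right; split.
  - split; first by exists W => //; have [[]] := Wg.
    move=> u v x [X CX Xu] [Y CY Yv].
    have lift2 Z : C Z -> Z u -> Z v -> (\bigcup_(X in C) X) (u + v *> x).
      move=> CZ Zu Zv; exists Z => //; have [Z0|[[_ +] _ _]] := CP _ CZ; last by apply.
      by rewrite Z0 in Zu.
    by have [XY|YX] := Ctot _ _ CX CY; [apply: (lift2 Y)|apply: (lift2 X)]; auto.
  - move=> u v [X CX Xu] [Y CY Yv].
    have lift2 Z : C Z -> Z u -> Z v -> phi u v = 0.
      move=> CZ Zu Zv; have [Z0|[_ + _]] := CP _ CZ; last by apply.
      by rewrite Z0 in Zu.
    by have [XY|YX] := Ctot _ _ CX CY; [apply: (lift2 Y)|apply: (lift2 X)]; auto.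
  - move=> u Uu; exists W => //; have [_ _] := Wg; exact.
have Ug : good U by split.
have Mg : good M.
  case: MU => // M0; case: (Mmax U); last by right.
  by rewrite M0; split; [exact: sub0set|move=> /(_ 0 U0.1)].
have [M1 M2 M3] := Mg; exists M => //; apply: phi_witt; split=> // W W1 W2 MW.
apply: contrapT => WM; apply: (Mmax W); last by right; split=> //; exact: subset_trans MW.
by split=> // WM'; apply: WM; rewrite eqEsubset.
Qed.

(** The span of e1, e2, w is totally isotropic, hence contained in a space of
    dimension 2. Geometrically, there are no triangles. *)
Lemma isotropic_in_plane e1 e2 w : indep e1 e2 ->
    phi e1 e1 = 0 -> phi e1 e2 = 0 -> phi e2 e2 = 0 ->
    phi e1 w = 0 -> phi e2 w = 0 -> phi w w = 0 ->
  plane e1 e2 w.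
Proof.
move=> ie e11 e12 e22 e1w e2w ww.
pose s : 'I_3 -> V := fun i => if i == 0 then e1 else if i == 1 then e2 else w.
have sE c : rcomb s c = e1 *> c 0 + e2 *> c 1 + w *> c (inord 2).
  rewrite /rcomb !big_ord_recl big_ord0 addr0 addrA /s /=.
  by congr (_ *> c _ + _ *> c _ + _ *> c _); apply/val_inj; rewrite //= inordK.
have e21 := hform_eq0 e12; have we1 := hform_eq0 e1w; have we2 := hform_eq0 e2w.
have [M M2 sM] : exists2 M : set V, has_rdim 2 M & rspan s `<=` M.
  apply: isotropic_subset_plane; first exact: rspan_subspace.
  move=> _ _ [c _ <-] [d _ <-]; rewrite !sE !hformE.
  by rewrite e11 e12 e22 e1w e2w ww e21 we1 we2 !(mulr0, mul0r) !addr0.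
have sM' i : M (s i).
  apply: sM; exists (fun j => (j == i)%:R) => //; rewrite /rcomb (bigD1 i) //= eqxx rscale1.
  by rewrite big1 ?addr0 // => j /negbTE ->; rewrite rscale0.
rewrite -(plane_basis Kdiv M2 (sM' 0) (sM' 1) ie).
have -> : w = s (inord 2); last exact: sM'.
by rewrite /s; case: eqP => [/(congr1 val)|_]; rewrite ?/= ?inordK //; case: eqP => [/(congr1 val)|_]; rewrite ?/= ?inordK.
Qed.

Hypothesis dimV : (5 <= dim V)%N.

(** The plane e1, e2 is completed by f1, f2 to two orthogonal hyperbolic planes;
    the vector u spans a direction in which isotropic vectors can be deformed. *)
Record frame e1 e2 f1 f2 u : Prop := Frame {
  frame_e1e1 : phi e1 e1 = 0; frame_e1e2 : phi e1 e2 = 0;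
  frame_e1f1 : phi e1 f1 = 1; frame_e1f2 : phi e1 f2 = 0;
  frame_e1u : phi e1 u = 0; frame_e2e2 : phi e2 e2 = 0;
  frame_e2f1 : phi e2 f1 = 0; frame_e2f2 : phi e2 f2 = 1;
  frame_e2u : phi e2 u = 0; frame_f1f1 : phi f1 f1 = 0;
  frame_f1f2 : phi f1 f2 = 0; frame_f1u : phi f1 u = 0;
  frame_f2f2 : phi f2 f2 = 0; frame_f2u : phi f2 u = 0;
  frame_uu : phi u u != 0 }.

(** All the values of phi on a frame except phi u u, as one rewriting rule. *)
Lemma gram e1 e2 f1 f2 u (H : frame e1 e2 f1 f2 u) :
  (((phi e1 e1 = 0) * (phi e1 e2 = 0) * (phi e1 f1 = 1) * (phi e1 f2 = 0)
    * (phi e1 u = 0))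
  * ((phi e2 e1 = 0) * (phi e2 e2 = 0) * (phi e2 f1 = 0) * (phi e2 f2 = 1)
    * (phi e2 u = 0))
  * ((phi f1 e1 = 1) * (phi f1 e2 = 0) * (phi f1 f1 = 0) * (phi f1 f2 = 0)
    * (phi f1 u = 0))
  * ((phi f2 e1 = 0) * (phi f2 e2 = 1) * (phi f2 f1 = 0) * (phi f2 f2 = 0)
    * (phi f2 u = 0))
  * ((phi u e1 = 0) * (phi u e2 = 0) * (phi u f1 = 0) * (phi u f2 = 0)))%type.
Proof.
case: H => *; do ! split => //; by [apply: hform_eq0|apply: hform_eq1].
Qed.

Lemma frame_swap e1 e2 f1 f2 u : frame e1 e2 f1 f2 u -> frame e2 e1 f2 f1 u.
Proof. by move=> H; split; rewrite ?(gram H) //; exact: frame_uu H. Qed.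

(** The dimension is at least 5, so some vector lies outside of the span of the
    four given ones. Its projection u to their orthogonal complement is not
    zero, and it is anisotropic: otherwise e1, e2, u would span a totally
    isotropic space of dimension 3. *)
Lemma exists_anisotropic e1 e2 f1 f2 : indep e1 e2 ->
    phi e1 e1 = 0 -> phi e1 e2 = 0 -> phi e1 f1 = 1 -> phi e1 f2 = 0 ->
    phi e2 e2 = 0 -> phi e2 f1 = 0 -> phi e2 f2 = 1 ->
    phi f1 f1 = 0 -> phi f1 f2 = 0 -> phi f2 f2 = 0 ->
  exists u, frame e1 e2 f1 f2 u.
Proof.
move=> ie e11 e12 e1f1 e1f2 e22 e2f1 e2f2 f11 f12 f22.
have e21 := hform_eq0 e12; have f1e1 := hform_eq1 e1f1.
have f2e1 := hform_eq0 e1f2; have f1e2 := hform_eq0 e2f1.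
have f2e2 := hform_eq1 e2f2; have f21 := hform_eq0 f12.
pose s : 'I_4 -> V := tnth [tuple e1; f1; e2; f2].
have [v vs] := exists_not_in_span Kdiv s dimV.
pose w := e1 *> phi f1 v + (f1 *> phi e1 v + (e2 *> phi f2 v + f2 *> phi e2 v)).
have ws : rspan s w.
  exists (tnth [tuple phi f1 v; phi e1 v; phi f2 v; phi e2 v]) => //.
  by rewrite /rcomb !big_ord_recl big_ord0 addr0 /s !(tnth_nth 0).
pose u := v - w.
have u0 : u != 0.
  by apply/eqP => /eqP; rewrite subr_eq0 => /eqP vw; apply: vs; rewrite vw.
have e1u : phi e1 u = 0.
  by rewrite /u /w !hformE e11 e1f1 e12 e1f2 !(mul0r, mul1r, add0r, addr0) subrr.
have f1u : phi f1 u = 0.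
  by rewrite /u /w !hformE f1e1 f11 f1e2 f12 !(mul0r, mul1r, add0r, addr0) subrr.
have e2u : phi e2 u = 0.
  by rewrite /u /w !hformE e21 e2f1 e22 e2f2 !(mul0r, mul1r, add0r, addr0) subrr.
have f2u : phi f2 u = 0.
  by rewrite /u /w !hformE f2e1 f21 f2e2 f22 !(mul0r, mul1r, add0r, addr0) subrr.
exists u; split=> //; apply/eqP => uu; case/eqP: u0.
have [x [y E]] := isotropic_in_plane ie e11 e12 e22 e1u e2u uu.
have x0 : x = 0.
  by move: f1u; rewrite E !hformE f1e1 f1e2 mul1r mul0r addr0.
have y0 : y = 0.
  by move: f2u; rewrite E !hformE f2e1 f2e2 mul1r mul0r add0r.
by rewrite E x0 y0 !rscale0 addr0.
Qed.

Lemma exists_frame_extending e1 e2 f2 : indep e1 e2 ->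
    phi e1 e1 = 0 -> phi e1 e2 = 0 -> phi e2 e2 = 0 ->
    phi e1 f2 = 0 -> phi e2 f2 = 1 -> phi f2 f2 = 0 ->
  exists f1 u, frame e1 e2 f1 f2 u.
Proof.
move=> ie e11 e12 e22 e1f2 e2f2 f22.
have [f1 [e1f1 e2f1 f11 f12]] := isotropic_dual_perp ie e11 e12 e22 e1f2 e2f2.
have [u H] := exists_anisotropic ie e11 e12 e1f1 e1f2 e22 e2f1 e2f2 f11 f12 f22.
by exists f1, u.
Qed.

Lemma exists_frame e1 e2 : indep e1 e2 ->
    phi e1 e1 = 0 -> phi e1 e2 = 0 -> phi e2 e2 = 0 ->
  exists f1 f2 u, frame e1 e2 f1 f2 u.
Proof.
move=> ie e11 e12 e22.
have ie' : indep e2 e1 by move=> x y; rewrite addrC => /ie[].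
have [f2 [e2f2 e1f2 f22]] := isotropic_dual ie' e22 (hform_eq0 e12).
have [f1 [u H]] := exists_frame_extending ie e11 e12 e22 e1f2 e2f2 f22.
by exists f1, f2, u.
Qed.

Lemma dual_neq0 g u : phi g u != 0 -> u != 0.
Proof. by apply: contraNneq => ->; rewrite hform0r. Qed.

(** Independence is read off a triangular matrix of values of phi. *)
Lemma indep_dual g h u v : phi g u != 0 -> phi g v = 0 -> phi h v != 0 ->
  indep u v.
Proof.
move=> gu gv hv x y E.
have x0 : x = 0.
  apply: (mulf0 Kdiv) gu; have := congr1 (phi g) E.
  by rewrite !hformE gv mul0r addr0 hform0r.
split=> //; apply: (mulf0 Kdiv) hv; have := congr1 (phi h) E.
by rewrite x0 !hformE mulr0 add0r hform0r.
Qed.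

(** * Deformations of isotropic vectors *)

Section FixedScalar.
Variable t : F.
Hypothesis sigma_t : sigma t%:A = t%:A.

Lemma sigma_tt : sigma (t * t)%:A = (t * t)%:A.
Proof. by rewrite -!scalerA -mulr_algl sigmaM sigma_t mulr_algl. Qed.

Lemma hform_perturbl v w1 w2 w :
  phi (perturb v w1 w2 t) w = phi v w + t *: phi w1 w + (t * t) *: phi w2 w.
Proof. by rewrite /perturb !hformE sigma_tt sigma_t !mulr_algl. Qed.

Lemma hform_perturbr v w1 w2 w :
  phi w (perturb v w1 w2 t) = phi w v + t *: phi w w1 + (t * t) *: phi w w2.
Proof. by rewrite /perturb !hformE !mulr_algr. Qed.

(** The norm of e + u t + f x t^2 is t^2 (phi u u + x + sigma x), which vanishes
    for x = - phi u u / 2. *)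
Lemma isotropic_deformation e u f : phi e e = 0 -> phi e u = 0 -> phi e f = 1 ->
    phi u f = 0 -> phi f f = 0 ->
  let g := perturb e u (f *> (- (2%:R^-1 *: phi u u))) t in
  phi g g = 0.
Proof.
move=> ee eu ef uf ff g.
have ue := hform_eq0 eu; have fe := hform_eq1 ef; have fu := hform_eq0 uf.
rewrite /g !(hform_perturbl, hform_perturbr) !hformE.
rewrite ee eu ef ue uf fe fu ff !(mulr0, mul0r, mul1r, mulr1, addr0, add0r, scaler0).
rewrite sigmaN sigma_half -?hform_sym // scalerA -!scalerDr -[X in _ + X + _]halfD.
by rewrite addKr subrr scaler0.
Qed.

End FixedScalar.

(* From here on, points are isotropic lines of V and lines are totally isotropic
   planes of V. *)
Context {R : realType} (a : absolute_value R F).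
Implicit Types (p q l m : set V).
Variable eps : F.
Hypotheses (eps_neq0 : eps != 0) (eps_lt1 : a eps < 1).
Hypothesis sigma_eps : sigma eps%:A = eps%:A.

Notation T n := (eps ^+ n).

Lemma T_neq0 n : T n != 0. Proof. exact: expf_neq0. Qed.

Lemma sigma_T n : sigma (T n)%:A = (T n)%:A.
Proof.
elim: n => [|n IH]; first by rewrite expr0 scale1r sigma1.
by rewrite exprS -scalerA -mulr_algl sigmaM IH sigma_eps mulr_algr mulr_algl.
Qed.

(** Incidence of a point and a line, which includes that they are such. *)
Definition inc p l :=
  [/\ isotropic_dim phi 1 p, isotropic_dim phi 2 l & p `<=` l].

Lemma ray_mem u : ray u u. Proof. by exists 1; rewrite rscale1. Qed.
Lemma plane_meml u v : plane u v u.
Proof. by exists 1, 0; rewrite rscale1 rscale0 addr0. Qed.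
Lemma plane_memr u v : plane u v v.
Proof. by exists 0, 1; rewrite rscale1 rscale0 add0r. Qed.
Lemma plane_comb u v x y : plane u v (u *> x + v *> y).
Proof. by exists x, y. Qed.

Lemma isotropic_ray u : u != 0 -> phi u u = 0 -> isotropic_dim phi 1 (ray u).
Proof.
move=> u0 uu; split.
  by exists (vec1 u); [exact: rfree_vec1|rewrite rspan_vec1].
by move=> _ _ [x ->] [y ->]; rewrite !hformE uu mul0r mulr0.
Qed.

Lemma isotropic_plane u v : indep u v -> phi u u = 0 -> phi u v = 0 ->
  phi v v = 0 -> isotropic_dim phi 2 (plane u v).
Proof.
move=> uv uu uv0 vv; split.
  by exists (vec2 u v); [exact: rfree_vec2|rewrite rspan_vec2].
have vu := hform_eq0 uv0.
by move=> _ _ [x [y ->]] [z [t ->]]; rewrite !hformE uu vv uv0 vu !(mulr0, mul0r, addr0).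
Qed.

Lemma isotropic1P p : isotropic_dim phi 1 p ->
  exists u, [/\ u != 0, phi u u = 0 & p = ray u].
Proof.
move=> [[s fs pE] pi]; exists (s 0).
have E : p = ray (s 0).
  rewrite pE -rspan_vec1; congr rspan; apply/funext => i; by rewrite [i]ord1.
split=> //; last by apply: pi; rewrite E; exact: ray_mem.
apply/eqP => s0; have /fs/(_ 0)/eqP : rcomb s (fun=> 1) = 0.
  by rewrite /rcomb big_ord1 rscale1.
by rewrite oner_eq0.
Qed.

Lemma isotropic2_closed l u v x y : isotropic_dim phi 2 l -> l u -> l v ->
  l (u *> x + v *> y).
Proof.
move=> [[s _ ->] _] lu lv; have [s0 sD] := rspan_subspace s.
by have := sD _ _ y (sD _ _ x s0 lu) lv; rewrite add0r.
Qed.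

Lemma isotropic2_scale l u x : isotropic_dim phi 2 l -> l u -> l (u *> x).
Proof.
by move=> li lu; have := isotropic2_closed x 0 li lu lu; rewrite rscale0 addr0.
Qed.

Lemma inc_ray u l : isotropic_dim phi 2 l -> l u -> u != 0 -> inc (ray u) l.
Proof.
move=> li lu u0; split=> //; first by apply: isotropic_ray => //; exact: li.2.
by move=> _ [x ->]; exact: isotropic2_scale.
Qed.

Lemma inc_vec p l : inc p l -> exists u, [/\ u != 0, l u, phi u u = 0 & p = ray u].
Proof.
move=> [/isotropic1P[u [u0 uu ->]] li pl]; exists u; split=> //.
by apply: pl; exact: ray_mem.
Qed.

(** A functional that vanishes on only one of two vectors separates their rays. *)
Lemma ray_neq g u v : phi g u = 0 -> phi g v != 0 -> ray u <> ray v.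
Proof.
move=> gu gv E; have : ray u v by rewrite E; exact: ray_mem.
by move=> [x vE]; move: gv; rewrite vE !hformE gu mul0r eqxx.
Qed.

Lemma indep_of_neq u v : u != 0 -> v != 0 -> ray u <> ray v -> indep u v.
Proof.
move=> u0 v0 uv; apply: indep_ray => //; apply: contra_not uv.
exact: ray_eq.
Qed.

Lemma plane_of_neq l u v : isotropic_dim phi 2 l -> l u -> l v -> u != 0 ->
  v != 0 -> ray u <> ray v -> l = plane u v.
Proof.
move=> li lu lv u0 v0 uv; apply: plane_basis => //; first exact: li.1.
exact: indep_of_neq.
Qed.

Lemma isotropic_in l u v w : isotropic_dim phi 2 l -> l u -> l v -> u != 0 ->
  v != 0 -> ray u <> ray v -> phi u w = 0 -> phi v w = 0 -> phi w w = 0 -> l w.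
Proof.
move=> li lu lv u0 v0 uv uw vw ww; rewrite (plane_of_neq li lu lv) //.
by apply: isotropic_in_plane => //;
  [exact: indep_of_neq|exact: li.2..].
Qed.

Lemma span_cvg_ray (un : nat -> V) u : (forall n, un n != 0) -> u != 0 ->
  (un n @[n --> \oo] --> (u : vect_top a V)) -> span_cvg a 1 (fun n => ray (un n)) (ray u).
Proof.
move=> un0 u0 cv; exists (fun n => vec1 (un n)), (vec1 u).
split=> [n||//|//]; rewrite ?rspan_vec1 //; last exact: rfree_vec1.
by split=> //; exact: rfree_vec1.
Qed.

Lemma span_cvg_plane (un vn : nat -> V) u v : (forall n, indep (un n) (vn n)) ->
  indep u v -> (un n @[n --> \oo] --> (u : vect_top a V)) ->
  (vn n @[n --> \oo] --> (v : vect_top a V)) ->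
  span_cvg a 2 (fun n => plane (un n) (vn n)) (plane u v).
Proof.
move=> uvn uv cu cv; exists (fun n => vec2 (un n) (vn n)), (vec2 u v).
split=> [n|||i]; rewrite ?rspan_vec2 //; last by rewrite /vec2; case: eqP.
  by split=> //; exact: rfree_vec2.
exact: rfree_vec2.
Qed.

Lemma span_cvg_cst k (U : set V) : has_rdim k U -> span_cvg a k (fun=> U) U.
Proof. by move=> [s fs US]; exists (fun=> s), s; split=> // i; exact: (@cvg_cst (vect_top a V)). Qed.

(** * Limits of quadrangles *)

Definition cycle4 (X : Type) (x0 x1 x2 x3 : X) (i : 'I_4) : X :=
  match val i with 0%N => x0 | 1%N => x1 | 2%N => x2 | _ => x3 end.

Lemma cycle4_inj (X : Type) (x0 x1 x2 x3 : X) :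
  [/\ x0 <> x1, x0 <> x2 & x0 <> x3] -> x1 <> x2 -> x1 <> x3 -> x2 <> x3 ->
  injective (cycle4 x0 x1 x2 x3).
Proof.
move=> [? ? ?] ? ? ? [[|[|[|[|//]]]] i] [[|[|[|[|//]]]] j]; rewrite /cycle4 //=;
  by move=> E; (try by []) || (try by apply/val_inj); exfalso; auto.
Qed.

(** The arguments are listed in the cyclic order of the octagon. *)
Definition closed_walk l0 p0 l1 p1 l2 p2 l3 p3 :=
  [/\ inc p0 l0 /\ inc p0 l1, inc p1 l1 /\ inc p1 l2,
      inc p2 l2 /\ inc p2 l3 & inc p3 l3 /\ inc p3 l0].

Definition limit_walk l0 p0 l1 p1 l2 p2 l3 p3 :=
  limit_circuit a phi (cycle4 p0 p1 p2 p3) (cycle4 l0 l1 l2 l3).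

Lemma circuit_cycle4 l0 p0 l1 p1 l2 p2 l3 p3 :
  closed_walk l0 p0 l1 p1 l2 p2 l3 p3 ->
  circuit phi (cycle4 p0 p1 p2 p3) (cycle4 l0 l1 l2 l3).
Proof.
move=> [[[? ? ?] [? ? ?]] [[? ? ?] [? ? ?]] [[? ? ?] [? ? ?]] [[? ? ?] [? ? ?]]].
by move=> [[|[|[|[|//]]]] i].
Qed.

Lemma limit_step (l0 p0 l1 p1 l2 p2 l3 p3 : nat -> set V) L0 P0 L1 P1 L2 P2 L3 P3 :
  (forall n, limit_walk (l0 n) (p0 n) (l1 n) (p1 n) (l2 n) (p2 n) (l3 n) (p3 n)) ->
  closed_walk L0 P0 L1 P1 L2 P2 L3 P3 ->
  span_cvg a 2 l0 L0 -> span_cvg a 1 p0 P0 -> span_cvg a 2 l1 L1 -> span_cvg a 1 p1 P1 ->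
  span_cvg a 2 l2 L2 -> span_cvg a 1 p2 P2 -> span_cvg a 2 l3 L3 -> span_cvg a 1 p3 P3 ->
  limit_walk L0 P0 L1 P1 L2 P2 L3 P3.
Proof.
move=> H W *; apply: (limit_circuit_lim H (circuit_cycle4 W)).
  by move=> [[|[|[|[|//]]]] i].
by move=> [[|[|[|[|//]]]] i].
Qed.

(** The symmetries of the octagon preserve quadrangles and convergence. *)
Lemma limit_circuit_sym (s s' : 'I_4 -> 'I_4) : injective s -> injective s' ->
  (forall P L, circuit phi P L -> circuit phi (P \o s) (L \o s')) ->
  forall P L, limit_circuit a phi P L -> limit_circuit a phi (P \o s) (L \o s').
Proof.
move=> si s'i H p l; elim=> {p l} [p l c pi li|p l p0 l0 _ IH c0 cp cl].
  by apply: limit_circuit_inj; [exact: H|exact: inj_comp|exact: inj_comp].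
by apply: (limit_circuit_lim IH (H _ _ c0)) => i; [exact: cp|exact: cl].
Qed.

Lemma limit_rot l0 p0 l1 p1 l2 p2 l3 p3 :
  limit_walk l0 p0 l1 p1 l2 p2 l3 p3 -> limit_walk l1 p1 l2 p2 l3 p3 l0 p0.
Proof.
move=> H.
have E X (x0 x1 x2 x3 : X) : cycle4 x1 x2 x3 x0 = cycle4 x0 x1 x2 x3 \o (@ordS 4).
  by apply/funext => -[[|[|[|[|//]]]] i].
rewrite /limit_walk (E _ p0) (E _ l0); apply: limit_circuit_sym H; [exact: ordS_inj|exact: ordS_inj|].
by move=> p l c i; have := c (ordS i); case: (c i).
Qed.

Lemma limit_rev l0 p0 l1 p1 l2 p2 l3 p3 :
  limit_walk l0 p0 l1 p1 l2 p2 l3 p3 -> limit_walk l3 p2 l2 p1 l1 p0 l0 p3.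
Proof.
move=> H.
pose s : 'I_4 -> 'I_4 := cycle4 (inord 2) (inord 1) (inord 0) (inord 3).
pose s' : 'I_4 -> 'I_4 := cycle4 (inord 3) (inord 2) (inord 1) (inord 0).
have Es : cycle4 p2 p1 p0 p3 = cycle4 p0 p1 p2 p3 \o s.
  by apply/funext => -[[|[|[|[|//]]]] i]; rewrite /= /s /cycle4 /= inordK.
have Es' : cycle4 l3 l2 l1 l0 = cycle4 l0 l1 l2 l3 \o s'.
  by apply/funext => -[[|[|[|[|//]]]] i]; rewrite /= /s' /cycle4 /= inordK.
rewrite /limit_walk Es Es'; apply: limit_circuit_sym H.
- by apply: cycle4_inj; [split|..] => /(congr1 val); rewrite /= !inordK.
- by apply: cycle4_inj; [split|..] => /(congr1 val); rewrite /= !inordK.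
move=> p l c i; split; [by case: (c (s i))|by case: (c (s' i))|..].
  have [_ _ _] := c (s i); rewrite /=.
  have -> // : ordS (s i) = s' i.
  by case: i => -[|[|[|[|//]]]] i; apply/val_inj; rewrite /= /s /s' /cycle4 /= !inordK.
have [_ _ + _] := c (s i); rewrite /=.
have -> // : s i = s' (ordS i).
by case: i => -[|[|[|[|//]]]] i; apply/val_inj; rewrite /= /s /s' /cycle4 /= !inordK.
Qed.

(** * Walks with opposite vertices *)

Lemma inc_plane p l : inc p l -> isotropic_dim phi 2 l. Proof. by case. Qed.
Lemma inc_mem p l u : inc p l -> p u -> l u. Proof. by case=> _ _; apply. Qed.

Definition perp p q := forall u v, p u -> q v -> phi u v = 0.

Lemma isotropic2_perp l u v : isotropic_dim phi 2 l -> l u -> l v -> phi u v = 0.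
Proof. by case=> _; apply. Qed.

Lemma perp_ray u v : phi u v = 0 -> perp (ray u) (ray v).
Proof. by move=> uv _ _ [x ->] [y ->]; rewrite !hformE uv mul0r mulr0. Qed.

Lemma perp_span l u v w (z : V) : isotropic_dim phi 2 l -> l u -> l v -> u != 0 ->
  v != 0 -> ray u <> ray v -> phi u z = 0 -> phi v z = 0 -> l w -> phi w z = 0.
Proof.
move=> li lu lv u0 v0 uv uz vz; rewrite (plane_of_neq li lu lv) // => -[x [y ->]].
by rewrite !hformE uz vz !mulr0 addr0.
Qed.

(** A coincidence between the vertices would put p0 and p2 on a common line, or
    both p1 and p3 on a line that contains p0 or p2; the latter line is then
    orthogonal to the other one of p0, p2. *)
Lemma limit_quadrangle l0 p0 l1 p1 l2 p2 l3 p3 :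
  closed_walk l0 p0 l1 p1 l2 p2 l3 p3 -> ~ perp p0 p2 -> p1 <> p3 ->
  limit_walk l0 p0 l1 p1 l2 p2 l3 p3.
Proof.
move=> W np p13; have c := circuit_cycle4 W.
case: W => [[i00 i01] [i11 i12] [i22 i23] [i33 i30]].
have [u0 [u00 l0u0 uu0 E0]] := inc_vec i00.
have [u1 [u10 l1u1 uu1 E1]] := inc_vec i11.
have [u2 [u20 l2u2 uu2 E2]] := inc_vec i22.
have [u3 [u30 l3u3 uu3 E3]] := inc_vec i33.
have l1u0 : l1 u0 by apply: (inc_mem i01); rewrite E0; exact: ray_mem.
have l2u1 : l2 u1 by apply: (inc_mem i12); rewrite E1; exact: ray_mem.
have l3u2 : l3 u2 by apply: (inc_mem i23); rewrite E2; exact: ray_mem.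
have l0u3 : l0 u3 by apply: (inc_mem i30); rewrite E3; exact: ray_mem.
have li0 := inc_plane i00; have li1 := inc_plane i11.
have li2 := inc_plane i22; have li3 := inc_plane i33.
have {}p13 : ray u1 <> ray u3 by rewrite -E1 -E3.
have n02 : phi u0 u2 <> 0 by move=> E; apply: np; rewrite E0 E2; exact: perp_ray.
have u02 := isotropic2_perp li1 l1u0 l1u1; have u12 := isotropic2_perp li2 l2u1 l2u2.
have u32 := isotropic2_perp li3 l3u3 l3u2; have u30' := isotropic2_perp li0 l0u3 l0u0.
have n20 : phi u2 u0 <> 0 by move=> /hform_eq0.
apply: (limit_circuit_inj _ c).
  rewrite E0 E1 E2 E3; apply: cycle4_inj => //; first split.
  - by apply: nesym; apply: (@ray_neq u2); [exact: hform_eq0|apply/eqP].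
  - by apply: (@ray_neq u0) => //; apply/eqP.
  - by apply: nesym; apply: (@ray_neq u2); [exact: hform_eq0|apply/eqP].
  - by apply: (@ray_neq u0) => //; apply/eqP.
  - by apply: nesym; apply: (@ray_neq u0); [exact: hform_eq0|apply/eqP].
apply: cycle4_inj; first split.
- move=> E; apply: n02; rewrite E in l0u3.
  exact: (perp_span li1 l1u1 l0u3 u10 u30 p13).
- by move=> E; apply: n02; apply: (isotropic2_perp li2) => //; rewrite -E.
- by move=> E; apply: n02; apply: (isotropic2_perp li3) => //; rewrite -E.
- by move=> E; apply: n02; apply: (isotropic2_perp li2) => //; rewrite -E.
- by move=> E; apply: n02; apply: (isotropic2_perp li3) => //; rewrite -E.
- move=> E; apply: n20; rewrite -E in l3u3.
  by apply: (perp_span li2 l2u1 l3u3 u10 u30 p13) => //; exact: hform_eq0.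
Qed.

(** The isotropic deformation of e in the direction u, for the parameter
    eps^n. *)
Definition deform e u f n := perturb e u (f *> (- (2%:R^-1 *: phi u u))) (T n).

Lemma cvg_deform e u f : deform e u f n @[n --> \oo] --> (e : vect_top a V).
Proof. exact: cvg_perturb. Qed.

Let pertl := fun n => hform_perturbl (sigma_T n).
Let pertr := fun n => hform_perturbr (T n).

(** As phi u u <> 0, the deformed vector is not orthogonal to e1, hence it spans
    a new point, but it keeps its products with the rest of the frame. *)
Lemma deformP e1 e2 f1 f2 u n : frame e1 e2 f1 f2 u ->
  let g := deform e1 u f1 n in
  [/\ phi g g = 0, phi e1 g != 0, phi e2 g = 0, phi f2 g = 0 & phi f1 g = 1].
Proof.
move=> H; have G := gram H.
split; rewrite /deform.
- by apply: (isotropic_deformation (sigma_T n)); rewrite G.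
- rewrite pertr !hformE !G scaler0 mul1r !add0r scalerN oppr_eq0 scalerA.
  by rewrite scaler_eq0 !mulf_eq0 invr_eq0 (negbTE two_neq0) (negbTE (T_neq0 n)) /= (frame_uu H).
- by rewrite pertr !hformE !G mul0r !scaler0 !addr0.
- by rewrite pertr !hformE !G mul0r !scaler0 !addr0.
- by rewrite pertr !hformE !G mul0r !scaler0 !addr0.
Qed.

(** If p1 = p3, then p1 moves among the isotropic points orthogonal to p0 and p2
    and the lines l1, l2 follow. *)
Lemma limit_opp_points l0 p0 l1 p1 l2 p2 l3 p3 :
  closed_walk l0 p0 l1 p1 l2 p2 l3 p3 -> ~ perp p0 p2 ->
  limit_walk l0 p0 l1 p1 l2 p2 l3 p3.
Proof.
move=> W np; have [p13|] := pselect (p1 = p3); last exact: limit_quadrangle.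
subst p3; have W' := W.
case: W => [[i00 i01] [i11 i12] [i22 i23] [i33 i30]].
have [x [x0 l0x xx E0]] := inc_vec i00.
have [v [v0 l1v vv E1]] := inc_vec i11.
have [y' [y'0 l2y' _ E2]] := inc_vec i22.
have xy' : phi x y' != 0.
  by apply/eqP => E; apply: np; rewrite E0 E2; exact: perp_ray.
pose y := y' *> (phi x y')^-1.
have xy : phi x y = 1 by rewrite /y !hformE mulxV.
have l1x : l1 x by apply: (inc_mem i01); rewrite E0; exact: ray_mem.
have l0v : l0 v by apply: (inc_mem i30); rewrite E1; exact: ray_mem.
have l2v : l2 v by apply: (inc_mem i12); rewrite E1; exact: ray_mem.
have l3v : l3 v by apply: (inc_mem i33); rewrite E1; exact: ray_mem.
have l3y' : l3 y' by apply: (inc_mem i23); rewrite E2; exact: ray_mem.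
have li0 := inc_plane i00; have li1 := inc_plane i11.
have li2 := inc_plane i22; have li3 := inc_plane i33.
have l2y : l2 y by apply: isotropic2_scale.
have l3y : l3 y by apply: isotropic2_scale.
have vx := isotropic2_perp li1 l1v l1x.
have vy := isotropic2_perp li2 l2v l2y; have yy := isotropic2_perp li2 l2y l2y.
have yx := hform_eq1 xy.
have y0 : y != 0 by apply: (@dual_neq0 x); rewrite xy oner_neq0.
have E2' : p2 = ray y.
  by rewrite E2; apply: ray_eq => //; exists ((phi x y')^-1).
have nvx : ray v <> ray x by apply: (@ray_neq y); rewrite ?(hform_eq0 vy) ?yx ?oner_neq0.
have nvy : ray v <> ray y by apply: (@ray_neq x); rewrite ?(hform_eq0 vx) ?xy ?oner_neq0.
(* The frame (v, x, w, y, u): deforming v along u keeps it orthogonal to x and y. *)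
have [w [u H]] := exists_frame_extending (indep_of_neq v0 x0 nvx) vv vx xx vy xy yy.
pose g := deform v u w.
have l1E : l1 = plane x v by apply: plane_of_neq => //; exact: nesym.
have l2E : l2 = plane y v by apply: plane_of_neq => //; exact: nesym.
have gP n : [/\ phi (g n) (g n) = 0, phi v (g n) != 0, phi x (g n) = 0 & phi y (g n) = 0].
  by have [? ? ? ? ?] := deformP n H.
have gn0 n : g n != 0.
  by have [_ vg _ _] := gP n; exact: (@dual_neq0 v).
have ixv n : indep x (g n).
  have [_ vg xg yg] := gP n; apply: (@indep_dual y v) => //.
  by rewrite yx oner_neq0.
have iyv n : indep y (g n).
  have [_ vg xg yg] := gP n; apply: (@indep_dual x v) => //.
  by rewrite xy oner_neq0.
have pxi n : isotropic_dim phi 2 (plane x (g n)).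
  by have [? ? ? ?] := gP n; apply: isotropic_plane.
have pyi n : isotropic_dim phi 2 (plane y (g n)).
  by have [? ? ? ?] := gP n; apply: isotropic_plane.
apply: (@limit_step (fun=> l0) (fun=> p0) (fun n => plane x (g n)) (fun n => ray (g n))
  (fun n => plane y (g n)) (fun=> p2) (fun=> l3) (fun=> p1)) W' _ _ _ _ _ _ _ _.
- move=> n; apply: limit_quadrangle => //; last first.
    rewrite E1; apply: nesym; apply: (@ray_neq v) => //; by case: (gP n).
  split=> //; split=> //.
  + by rewrite E0; apply: inc_ray => //; exact: plane_meml.
  + by apply: inc_ray => //; exact: plane_memr.
  + by apply: inc_ray => //; exact: plane_memr.
  + by rewrite E2'; apply: inc_ray => //; exact: plane_meml.
- apply: span_cvg_cst; exact: li0.1.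
- apply: span_cvg_cst; by case: i00 => -[].
- rewrite l1E; apply: span_cvg_plane => //; last exact: cvg_deform.
    by apply: indep_of_neq => //; exact: nesym.
  exact: (@cvg_cst (vect_top a V)).
- rewrite E1; apply: span_cvg_ray => //; exact: cvg_deform.
- rewrite l2E; apply: span_cvg_plane => //; last exact: cvg_deform.
    by apply: indep_of_neq => //; exact: nesym.
  exact: (@cvg_cst (vect_top a V)).
- apply: span_cvg_cst; by case: i22 => -[].
- apply: span_cvg_cst; exact: li3.1.
- apply: span_cvg_cst; by case: i33 => -[].
Qed.

Lemma closed_walk_rot l0 p0 l1 p1 l2 p2 l3 p3 :
  closed_walk l0 p0 l1 p1 l2 p2 l3 p3 -> closed_walk l1 p1 l2 p2 l3 p3 l0 p0.
Proof. by case=> -[? ?] [? ?] [? ?] [? ?]. Qed.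

Lemma closed_walk_rev l0 p0 l1 p1 l2 p2 l3 p3 :
  closed_walk l0 p0 l1 p1 l2 p2 l3 p3 -> closed_walk l3 p2 l2 p1 l1 p0 l0 p3.
Proof. by case=> -[? ?] [? ?] [? ?] [? ?]. Qed.

(** Two lines of a generalized quadrangle are opposite when they do not meet. *)
Definition opposite_lines l m := forall w, l w -> m w -> w = 0.

Lemma ray_neq_opposite l m u v : isotropic_dim phi 2 m -> opposite_lines l m -> l u -> m v ->
  u != 0 -> ray u <> ray v.
Proof.
move=> mi lm lu mv u0 E; case/eqP: u0; apply: lm => //.
have : ray v u by rewrite -E; exact: ray_mem.
by move=> [x ->]; exact: isotropic2_scale.
Qed.

Lemma indep_shift u v x : indep u v -> indep u (v + u *> x).
Proof.
move=> uv y z; rewrite rscaleDl rscaleA addrCA -rscaleDr addrC => /uv[+ z0].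
by rewrite z0 mulr0 addr0.
Qed.

Lemma perturb_neq0 u v n : indep u v -> perturb u v 0 (T n) != 0.
Proof.
move=> uv; rewrite /perturb rscale0l addr0; apply/eqP => E.
have [] := uv 1 (T n)%:A; first by rewrite rscale1.
by move/eqP; rewrite oner_eq0.
Qed.

Lemma perturb_ray u v n : indep u v -> ray (perturb u v 0 (T n)) <> ray u.
Proof.
move=> uv E; have : ray u (perturb u v 0 (T n)) by rewrite -E; exact: ray_mem.
rewrite /perturb rscale0l addr0 => -[x Ex].
have [] := uv (1 - x) (T n)%:A.
  by rewrite rscaleDr rscale1 rscaleN addrAC Ex subrr.
by move=> _ /eqP; rewrite scaler_eq0 (negbTE (T_neq0 n)) oner_eq0.
Qed.

Lemma perturb_in l u v n : isotropic_dim phi 2 l -> l u -> l v ->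
  l (perturb u v 0 (T n)).
Proof.
move=> li lu lv; rewrite /perturb rscale0l addr0 -[u]rscale1.
exact: isotropic2_closed.
Qed.

Lemma cvg_perturbT v w1 w2 : perturb v w1 w2 (T n) @[n --> \oo] --> (v : vect_top a V).
Proof. exact: cvg_perturb. Qed.

Lemma cvg_cstV v : (fun=> v) n @[n --> \oo] --> (v : vect_top a V).
Proof. exact: (@cvg_cst (vect_top a V)). Qed.

Lemma span_cvg_cst_point p l : inc p l -> span_cvg a 1 (fun=> p) p.
Proof. by case=> -[? _] _ _; exact: span_cvg_cst. Qed.
Lemma span_cvg_cst_plane l : isotropic_dim phi 2 l -> span_cvg a 2 (fun=> l) l.
Proof. by case=> ? _; exact: span_cvg_cst. Qed.

Lemma inc_eq_vec p l u : inc p l -> p = ray u -> l u.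
Proof. by move=> i E; apply: (inc_mem i); rewrite E; exact: ray_mem. Qed.

(** If p0 <> p3, then p0 and p2 are not orthogonal, since otherwise p2 would be
    on l0. If p0 = p3, then p1 = p2 is the unique point of l2 orthogonal to it;
    the point p3 moves along l0, and p2 moves to the orthogonal point of l2. *)
Lemma limit_opp_lines l0 p0 l1 p1 l2 p2 l3 p3 :
  closed_walk l0 p0 l1 p1 l2 p2 l3 p3 -> opposite_lines l0 l2 ->
  limit_walk l0 p0 l1 p1 l2 p2 l3 p3.
Proof.
have distinct : forall l0 p0 l1 p1 l2 p2 l3 p3,
    closed_walk l0 p0 l1 p1 l2 p2 l3 p3 -> opposite_lines l0 l2 -> p0 <> p3 ->
    limit_walk l0 p0 l1 p1 l2 p2 l3 p3.
  move=> {l0 p0 l1 p1 l2 p2 l3 p3} l0 p0 l1 p1 l2 p2 l3 p3 W D p03.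
  apply: limit_opp_points => // P02.
  case: W => [[i00 i01] [i11 i12] [i22 i23] [i33 i30]].
  have [u0 [u00 l0u0 uu0 E0]] := inc_vec i00.
  have [u2 [u20 l2u2 uu2 E2]] := inc_vec i22.
  have [u3 [u30 l3u3 uu3 E3]] := inc_vec i33.
  case/eqP: u20; apply: D => //.
  apply: (isotropic_in (inc_plane i00) l0u0 (inc_eq_vec i30 E3)) => //.
  - by rewrite -E0 -E3.
  - by apply: P02; rewrite ?E0 ?E2; exact: ray_mem.
  - exact: isotropic2_perp (inc_plane i33) l3u3 (inc_eq_vec i23 E2).
move=> W D; have [p03|] := pselect (p0 = p3); last exact: distinct.
subst p3; have W' := W.
case: W => [[i00 i01] [i11 i12] [i22 i23] [i33 i30]].
have li0 := inc_plane i00; have li1 := inc_plane i11.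
have li2 := inc_plane i22; have li3 := inc_plane i33.
have [x [x0 l0x xx E0]] := inc_vec i00.
have [y [y0 l2y yy E2]] := inc_vec i22.
have l3x := inc_eq_vec i33 E0; have l3y := inc_eq_vec i23 E2.
have xy := isotropic2_perp li3 l3x l3y.
have p12 : p1 = p2.
  apply: contrapT => p12; have [z [z0 l2z zz E1]] := inc_vec i12.
  case/eqP: x0; apply: D => //; apply: (isotropic_in li2 l2y l2z) => //.
  - by rewrite -E1 -E2; exact: nesym.
  - exact: hform_eq0.
  - exact: isotropic2_perp li1 (inc_eq_vec i11 E1) (inc_eq_vec i01 E0).
subst p1; have l1x := inc_eq_vec i01 E0; have l1y := inc_eq_vec i11 E2.
have [x' [l0x' ixx' l0E]] := plane_extend Kdiv li0.1 l0x x0.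
have [y' [l2y' iyy' l2E]] := plane_extend Kdiv li2.1 l2y y0.
have y'0 : y' != 0.
  apply/eqP => E; have [] := iyy' 0 1; first by rewrite E rscale0 rscale0l addr0.
  by move=> _ /eqP; rewrite oner_eq0.
have nyy' : ray y <> ray y'.
  move=> E; have [z Ez] : ray y y' by rewrite E; exact: ray_mem.
  have [] := iyy' z (-1); first by rewrite rscaleN rscale1 -Ez subrr.
  by move=> _ /eqP; rewrite oppr_eq0 oner_eq0.
have al0 : phi x y' != 0.
  apply/eqP => E; case/eqP: x0; apply: D => //.
  by apply: (isotropic_in li2 l2y l2y') => //; exact: hform_eq0.
(* With x2 orthogonal to y', the product of x + x2 t and y + y' c t has no term
   of degree 2 in t, and c cancels the term of degree 1. *)
pose x2 := x' + x *> (- sigma (phi x' y' * (phi x y')^-1)).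
have ix2 : indep x x2 by exact: indep_shift.
have l0x2 : l0 x2 by rewrite /x2 -[x']rscale1; apply: isotropic2_closed.
have x2y' : phi x2 y' = 0.
  by rewrite /x2 !hformE sigmaN sigmaK mulNr -mulrA mulVx // mulr1 subrr.
clearbody x2; pose c := - ((phi x y')^-1 * phi x2 y).
pose pn n := perturb x x2 0 (T n); pose qn n := perturb y (y' *> c) 0 (T n).
have l0p n : l0 (pn n) by exact: perturb_in.
have l2q n : l2 (qn n) by apply: perturb_in => //; exact: isotropic2_scale.
have pn0 n : pn n != 0 by exact: perturb_neq0.
have qn0 n : qn n != 0.
  rewrite /qn /perturb rscale0l addr0 rscaleA -[y in y + _]rscale1; apply/eqP => /iyy'[].
  by move/eqP; rewrite oner_eq0.
have pq n : phi (pn n) (qn n) = 0.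
  rewrite pertl !pertr !hformE xy x2y' /c mul0r mulrN mulrA mulxV // mul1r.
  by rewrite !simp0 scalerN addNr.
have npq n : ray (pn n) <> ray (qn n) by exact: (ray_neq_opposite li2 D).
have ipq n : indep (pn n) (qn n) by exact: indep_of_neq.
have pqi n : isotropic_dim phi 2 (plane (pn n) (qn n)).
  apply: isotropic_plane => //; first exact: (isotropic2_perp li0).
  exact: (isotropic2_perp li2).
have nxy : ray x <> ray y by exact: (ray_neq_opposite li2 D).
apply: (@limit_step (fun=> l0) (fun=> p0) (fun=> l1) (fun=> p2)
  (fun=> l2) (fun n => ray (qn n)) (fun n => plane (pn n) (qn n))
  (fun n => ray (pn n)) _ _ _ _ _ _ _ _ _ W').
- move=> n; apply: distinct => //; last first.
    by rewrite E0; apply: nesym; exact: perturb_ray.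
  split=> //; split; by [|apply: inc_ray => //; exact: plane_meml|
    apply: inc_ray => //; exact: plane_memr].
- exact: span_cvg_cst_plane.
- exact: span_cvg_cst_point i00.
- exact: span_cvg_cst_plane.
- exact: span_cvg_cst_point i11.
- exact: span_cvg_cst_plane.
- rewrite E2; apply: span_cvg_ray => //; exact: cvg_perturbT.
- rewrite (plane_of_neq li3 l3x l3y) //.
  by apply: span_cvg_plane => //; [exact: indep_of_neq|exact: cvg_perturbT..].
- rewrite E0; apply: span_cvg_ray => //; exact: cvg_perturbT.
Qed.

Lemma limit_opp_lines_shift l0 p0 l1 p1 l2 p2 l3 p3 :
  closed_walk l0 p0 l1 p1 l2 p2 l3 p3 -> opposite_lines l1 l3 ->
  limit_walk l0 p0 l1 p1 l2 p2 l3 p3.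
Proof.
move=> W D; do 3!apply: limit_rot; apply: limit_opp_lines => //.
exact: closed_walk_rot.
Qed.

(** * Moving a point or a line *)

(** No point of a line is isolated on it. *)
Lemma point_perturb p q l : inc p l -> exists pn : nat -> set V,
  (forall n, inc (pn n) l /\ pn n <> q) /\ span_cvg a 1 pn p.
Proof.
move=> i; have [pq|pq] := pselect (p = q); last first.
  by exists (fun=> p); split=> //; exact: span_cvg_cst_point i.
subst q; have li := inc_plane i; have [e1 [e10 le1 _ E]] := inc_vec i.
have [e2 [le2 ie lE]] := plane_extend Kdiv li.1 le1 e10.
exists (fun n => ray (perturb e1 e2 0 (T n))); split; last first.
  by rewrite E; apply: span_cvg_ray => // [n|]; [exact: perturb_neq0|exact: cvg_perturbT].
move=> n; split; last by rewrite E; exact: perturb_ray.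
by apply: inc_ray => //; [exact: perturb_in|exact: perturb_neq0].
Qed.

(** No line through a point is isolated among them: a second vector of the line
    is deformed in an anisotropic direction. *)
Lemma line_perturb p l m : inc p l -> exists ln : nat -> set V,
  (forall n, inc p (ln n) /\ ln n <> m) /\ span_cvg a 2 ln l.
Proof.
move=> i; have [lm|lm] := pselect (l = m); last first.
  by exists (fun=> l); split=> //; exact: span_cvg_cst_plane (inc_plane i).
subst m; have li := inc_plane i; have [e1 [e10 le1 e11 E]] := inc_vec i.
have [e2 [le2 ie lE]] := plane_extend Kdiv li.1 le1 e10.
have [f1 [f2 [u H]]] := exists_frame ie e11 (li.2 _ _ le1 le2) (li.2 _ _ le2 le2).
have G := gram H.
have gP n := deformP n (frame_swap H).
have ig n : indep e1 (deform e2 u f2 n).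
  have [gg e2g e1g f1g _] := gP n.
  by apply: (@indep_dual f1 e2) => //; rewrite G oner_neq0.
have gi n : isotropic_dim phi 2 (plane e1 (deform e2 u f2 n)).
  by have [gg e2g e1g f1g _] := gP n; apply: isotropic_plane.
exists (fun n => plane e1 (deform e2 u f2 n)); split; last first.
  by rewrite lE; apply: span_cvg_plane => //; [exact: cvg_cstV|exact: cvg_deform].
move=> n; split; first by rewrite E; apply: inc_ray => //; exact: plane_meml.
move=> lE'; have [_ /eqP e2g _ _ _] := gP n; apply: e2g.
by apply: (isotropic2_perp li) => //; rewrite -lE'; exact: plane_memr.
Qed.

(** The vector e2 cannot be orthogonal to m, because there are no triangles. *)
Lemma transversal l m e1 e2 : isotropic_dim phi 2 l -> isotropic_dim phi 2 m ->
    l e1 -> m e1 -> e1 != 0 -> l e2 -> e2 != 0 -> ray e1 <> ray e2 -> m <> l ->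
  exists x : V, [/\ m x, phi e2 x = 1, ray e1 <> ray x & m = plane e1 x].
Proof.
move=> li mi le1 me1 e10 le2 e20 n12 ml.
have [v [mv iv mE]] := plane_extend Kdiv mi.1 me1 e10.
have e2v : phi e2 v != 0.
  apply/eqP => E; apply: ml; rewrite mE; symmetry; apply: plane_basis => //.
    exact: li.1.
  apply: (isotropic_in li le1 le2) => //; first exact: (isotropic2_perp mi).
  exact: (isotropic2_perp mi).
have mx : m (v *> (phi e2 v)^-1) by exact: isotropic2_scale.
have e2x : phi e2 (v *> (phi e2 v)^-1) = 1 by rewrite !hformE mulxV.
have n1x : ray e1 <> ray (v *> (phi e2 v)^-1).
  apply: (@ray_neq e2); last by rewrite e2x oner_neq0.
  exact: (isotropic2_perp li).
exists (v *> (phi e2 v)^-1); split=> //; apply: plane_of_neq => //.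
by apply: (@dual_neq0 e2); rewrite e2x oner_neq0.
Qed.

(** * Forks *)

(** The second visit of p moves along la to the point z = e1 + x t, which is not
    orthogonal to q. The line lb is dragged along to the line of z and y', where
    y' is a correction of y orthogonal to z, and b = z - y' t is the point of
    the new lb that is orthogonal to q. All of them tend to the vertices of the
    fork. *)
Lemma limit_fork_transversal l la lb p q : inc p l -> inc q l -> inc p la -> inc p lb ->
  p <> q -> la <> l -> lb <> l -> limit_walk l q l p la p lb p.
Proof.
move=> il iq ia ib pq nal nbl.
have li := inc_plane il; have lai := inc_plane ia; have lbi := inc_plane ib.
have [e1 [e10 le1 e11 E1]] := inc_vec il.
have [e2 [e20 le2 e22 E2]] := inc_vec iq.
have {pq}n12 : ray e1 <> ray e2 by rewrite -E1 -E2.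
have ae1 := inc_eq_vec ia E1; have be1 := inc_eq_vec ib E1.
have [x [ax e2x n1x laE]] := transversal li lai le1 ae1 e10 le2 e20 n12 nal.
have [y0 [by0 e2y0 _ _]] := transversal li lbi le1 be1 e10 le2 e20 n12 nbl.
have e12 := isotropic2_perp li le1 le2.
have e1x := isotropic2_perp lai ae1 ax; have xx := isotropic2_perp lai ax ax.
have i12 := indep_of_neq e10 e20 n12.
have [f1 [u H]] := exists_frame_extending i12 e11 e12 e22 e1x e2x xx.
have G := gram H.
pose y := y0 + e1 *> (- phi f1 y0).
have lby : lb y by rewrite /y -[y0 in y0 + _]rscale1; exact: isotropic2_closed.
have e1y := isotropic2_perp lbi be1 lby; have ye1 := hform_eq0 e1y.
have yy := isotropic2_perp lbi lby lby.
have e2y : phi e2 y = 1 by rewrite /y !hformE G e2y0 mul0r addr0.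
have ye2 := hform_eq1 e2y.
have f1y : phi f1 y = 0 by rewrite /y !hformE G mul1r subrr.
have yf1 := hform_eq0 f1y.
clearbody y; have y_neq0 : y != 0 by apply: (@dual_neq0 e2); rewrite e2y oner_neq0.
have n1y : ray e1 <> ray y.
  by apply: (@ray_neq e2); rewrite ?G ?e2y ?oner_neq0.
pose s := phi x y.
pose z n := perturb e1 x 0 (T n).
pose y' n := perturb y (f1 *> (- s)) 0 (T n).
pose b n := perturb e1 (x - y) (f1 *> s) (T n).
have az n : la (z n) by exact: perturb_in.
have bE n : b n = z n *> 1 + y' n *> (- (T n)%:A).
  rewrite rscale1 rscaleN /b /z /y' /perturb !rscale0l !addr0.
  rewrite !rscaleDl !rscaleNl !opprD !rscaleA !addrA; congr (_ + _).
  rewrite -!rscaleN mulNr opprK; congr (_ *> _).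
  by congr (_ * _); rewrite mulr_algr scalerA.
have f1z n : phi f1 (z n) = 1.
  by rewrite /z pertr !G !simp0.
have f1y' n : phi f1 (y' n) = 0.
  by rewrite /y' pertr hformE !G f1y !simp0.
have e2y' n : phi e2 (y' n) = 1.
  by rewrite /y' pertr hformE !G e2y !simp0.
have e2z n : phi e2 (z n) = (T n)%:A.
  by rewrite /z pertr !G !simp0.
have f1b n : phi f1 (b n) = 1.
  by rewrite /b pertr !hformE !G f1y oppr0 !simp0.
have izy n : indep (z n) (y' n).
  by apply: (@indep_dual f1 e2); rewrite ?f1z ?e2y' ?oner_neq0.
have ibe n : indep (b n) e2.
  by apply: (@indep_dual f1 x); rewrite ?f1b ?G ?oner_neq0.
have zz n : phi (z n) (z n) = 0 by exact: (isotropic2_perp lai).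
have zy' n : phi (z n) (y' n) = 0.
  rewrite /z pertl /y' !pertr !hformE !G e1y -/s mul1r !simp0.
  by rewrite scalerN addNr.
have y'y' n : phi (y' n) (y' n) = 0.
  by rewrite /y' pertl !pertr !hformE !G yy yf1 f1y !simp0.
have l3i n : isotropic_dim phi 2 (plane (z n) (y' n)) by exact: isotropic_plane.
have l3b n : plane (z n) (y' n) (b n) by rewrite bE; exact: plane_comb.
have be2 n : phi (b n) e2 = 0.
  by rewrite /b pertl !hformE !G ye2 subrr !simp0.
have l0i n : isotropic_dim phi 2 (plane (b n) e2).
  apply: isotropic_plane => //; exact: (isotropic2_perp (l3i n)).
have z0 n : z n != 0 by apply: (@dual_neq0 f1); rewrite f1z oner_neq0.
have b0 n : b n != 0 by apply: (@dual_neq0 f1); rewrite f1b oner_neq0.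
apply: (@limit_step (fun n => plane (b n) e2) (fun=> q) (fun=> l) (fun=> p)
  (fun=> la) (fun n => ray (z n)) (fun n => plane (z n) (y' n)) (fun n => ray (b n))).
- move=> n; apply: limit_opp_points; last first.
    move=> /(_ e2 (z n)); rewrite E2 e2z => /(_ (ray_mem _) (ray_mem _))/eqP.
    by rewrite scaler_eq0 oner_eq0 orbF (negbTE (T_neq0 n)).
  split=> //; split=> //.
  + by rewrite E2; apply: inc_ray => //; exact: plane_memr.
  + by apply: inc_ray.
  + by apply: inc_ray => //; exact: plane_meml.
  + by apply: inc_ray.
  + by apply: inc_ray => //; exact: plane_meml.
- by split.
- rewrite (plane_of_neq li le1 le2) //.
  by apply: span_cvg_plane => //; [exact: cvg_perturbT|exact: cvg_cstV].
- exact: span_cvg_cst_point iq.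
- exact: span_cvg_cst_plane.
- exact: span_cvg_cst_point il.
- exact: span_cvg_cst_plane.
- by rewrite E1; apply: span_cvg_ray => //; exact: cvg_perturbT.
- rewrite (plane_of_neq lbi be1 lby) //.
  by apply: span_cvg_plane => //; [exact: indep_of_neq|exact: cvg_perturbT..].
- by rewrite E1; apply: span_cvg_ray => //; exact: cvg_perturbT.
Qed.

(** A branch of the fork that coincides with l is first moved away from it. *)
Lemma limit_fork l la lb p q : inc p l -> inc q l -> inc p la -> inc p lb ->
  p <> q -> limit_walk l q l p la p lb p.
Proof.
move=> il iq ia ib pq.
have [an [anP can]] := line_perturb l ia; have [bn [bnP cbn]] := line_perturb l ib.
apply: (@limit_step (fun=> l) (fun=> q) (fun=> l) (fun=> p) an (fun=> p) bn (fun=> p)) => //;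
  try by [exact: span_cvg_cst_plane (inc_plane il)|exact: span_cvg_cst_point il|exact: span_cvg_cst_point iq].
by move=> n; have [? ?] := anP n; have [? ?] := bnP n; exact: limit_fork_transversal.
Qed.

Lemma perturb_rscale v w1 w2 n e x :
  e + perturb v w1 w2 (T n) *> x =
  perturb (e + v *> x) (w1 *> x) (w2 *> x) (T n).
Proof.
rewrite /perturb !rscaleDl !rscaleA !addrA; congr (_ + _ *> _ + _ *> _);
by rewrite mulr_algl mulr_algr.
Qed.

Lemma deform_pair e1 e2 f1 f2 u n : frame e1 e2 f1 f2 u ->
  phi e1 (deform e1 u f1 n) = (T n * T n) *: (- (2%:R^-1 *: phi u u)).
Proof.
by move=> H; have G := gram H; rewrite /deform pertr hformE !G mul1r !simp0.
Qed.

Lemma point_coordinates l e1 e2 r : l = plane e1 e2 -> e1 != 0 -> inc r l ->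
  r <> ray e1 ->
  exists v c k, [/\ v != 0, l v, r = ray v, v = e1 *> c + e2 *> k & k != 0].
Proof.
move=> lE e10 ir nr; have [v [v0 lv vv Ev]] := inc_vec ir.
have [c [k vE]] : plane e1 e2 v by rewrite -lE.
exists v, c, k; split=> //; apply/eqP => k0; apply: nr; rewrite Ev; symmetry.
by apply: ray_eq => //; exists c; rewrite vE k0 rscale0 addr0.
Qed.

(** The last visit of l becomes a line opposite to l1: the line of e2 and g, where
    g deforms e1 in an anisotropic direction. The point r follows to e2 + g d,
    and p0 is the point of l1 orthogonal to it; it differs from e1 by a term
    in t^2. *)
Lemma limit_cofork l l1 p q r : inc p l -> inc q l -> inc r l -> inc p l1 ->
  l1 <> l -> q <> p -> r <> p -> limit_walk l p l1 p l q l r.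
Proof.
move=> il iq ir i1 nl1 nq nr.
have li := inc_plane il; have l1i := inc_plane i1.
have [e1 [e10 le1 e11 E1]] := inc_vec il.
have [e2 [e20 le2 e22 E2]] := inc_vec iq.
have n12 : ray e1 <> ray e2 by rewrite -E1 -E2; exact: nesym.
have l1e1 := inc_eq_vec i1 E1.
have e12 := isotropic2_perp li le1 le2.
have i12 := indep_of_neq e10 e20 n12.
have lE := plane_of_neq li le1 le2 e10 e20 n12.
have [x [l1x e2x n1x l1E]] := transversal li l1i le1 l1e1 e10 le2 e20 n12 nl1.
have e1x := isotropic2_perp l1i l1e1 l1x; have xx := isotropic2_perp l1i l1x l1x.
have [f1 [u H]] := exists_frame_extending i12 e11 e12 e22 e1x e2x xx.
have G := gram H.
(* The points of l other than p are spanned by the vectors e2 + e1 d. *)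
have [d [lr Er]] : exists d, l (e2 + e1 *> d) /\ r = ray (e2 + e1 *> d).
  have nr1 : r <> ray e1 by rewrite -E1.
  have [v [c [k [v0 lv Ev vE k0]]]] := point_coordinates lE e10 ir nr1.
  exists (c * k^-1).
  have E : v *> k^-1 = e2 + e1 *> (c * k^-1).
    by rewrite vE rscaleDl !rscaleA mulxV // rscale1 addrC.
  rewrite -E; split; first exact: isotropic2_scale.
  rewrite Ev; apply: ray_eq => //; last by exists k^-1.
  by apply/eqP => Z; case/negP: (invx0 k0); apply/eqP; exact: (rscale_eq0 Kdiv Z v0).
pose h := 2%:R^-1 *: phi u u.
have sh : sigma h = h by apply: sigma_half; rewrite -hform_sym.
have [g gE] : exists g : nat -> V, g = deform e1 u f1 by exists (deform e1 u f1).
have gP n : [/\ phi (g n) (g n) = 0, phi e1 (g n) != 0, phi e2 (g n) = 0,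
  phi x (g n) = 0 & phi f1 (g n) = 1] by rewrite gE; exact: deformP n H.
have e1g n : phi e1 (g n) = (T n * T n) *: (- h).
  by rewrite gE; exact: deform_pair n H.
pose p3 n := e2 + g n *> d.
pose p0 n := perturb e1 0 (x *> (sigma d * h)) (T n).
have e2g n : phi e2 (g n) = 0 by have [] := gP n.
have xg n : phi x (g n) = 0 by have [] := gP n.
have f1g n : phi f1 (g n) = 1 by have [] := gP n.
have gg n : phi (g n) (g n) = 0 by have [] := gP n.
have ge2 n := hform_eq0 (e2g n).
have p33 n : phi (p3 n) (p3 n) = 0 by rewrite /p3 !hformE e22 gg ge2 e2g !simp0.
have e1p3 n : phi e1 (p3 n) = (T n * T n) *: (- (h * d)).
  by rewrite /p3 !hformE e12 add0r e1g -scalerAl mulNr.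
have xp3 n : phi x (p3 n) = 1 by rewrite /p3 !hformE G xg !simp0.
have p03 n : phi (p0 n) (p3 n) = 0.
  rewrite /p0 pertl hformE e1p3 xp3 mulr1 sigmaM sigmaK sh !simp0.
  by rewrite scalerN addNr.
have l1p0 n : l1 (p0 n).
  rewrite /p0 /perturb rscale0l addr0 rscaleA -[e1 in e1 + _]rscale1.
  exact: isotropic2_closed.
have f1p0 n : phi f1 (p0 n) = 1 by rewrite /p0 pertr hformE !G !simp0.
have e2p0 n : phi x (p0 n) = 0 by rewrite /p0 pertr hformE !G ?xx !simp0.
have p0_neq0 n : p0 n != 0 by apply: (@dual_neq0 f1); rewrite f1p0 oner_neq0.
have p3_neq0 n : p3 n != 0 by apply: (@dual_neq0 x); rewrite xp3 oner_neq0.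
have i03 n : indep (p3 n) (p0 n).
  by apply: (@indep_dual x f1); rewrite ?xp3 ?f1p0 ?oner_neq0.
have l0i n : isotropic_dim phi 2 (plane (p3 n) (p0 n)).
  apply: isotropic_plane => //; first exact: hform_eq0.
  exact: (isotropic2_perp l1i).
have ige2 n : indep (g n) e2.
  by apply: (@indep_dual f1 x); rewrite ?f1g ?G ?oner_neq0.
have l3i n : isotropic_dim phi 2 (plane (g n) e2) by exact: isotropic_plane.
have l3p3 n : plane (g n) e2 (p3 n) by rewrite /p3 addrC -[e2 in _ + e2]rscale1; exact: plane_comb.
have D n : opposite_lines l1 (plane (g n) e2).
  move=> w; rewrite l1E => -[al [be ->]] [al' [be' E]].
  have E1' := congr1 (phi x) E; have E2' := congr1 (phi e1) E.
  move: E1' E2'; rewrite !hformE !G ?xx xg !simp0 mul1r => /esym be0 E0.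
  have [_ e1g0 _ _ _] := gP n.
  have al0 : al' = 0 by exact: (mulf0 Kdiv (esym E0)).
  by rewrite E al0 be0 !rscale0 addr0.
apply: (@limit_step (fun n => plane (p3 n) (p0 n)) (fun n => ray (p0 n)) (fun=> l1) (fun=> p)
  (fun=> l) (fun=> q) (fun n => plane (g n) e2) (fun n => ray (p3 n))).
- move=> n; apply: limit_opp_lines_shift => //; split=> //; split=> //.
  + by apply: inc_ray => //; exact: plane_memr.
  + exact: inc_ray.
  + by rewrite E2; apply: inc_ray => //; exact: plane_memr.
  + exact: inc_ray.
  + by apply: inc_ray => //; exact: plane_meml.
- by split.
- have r0 : e2 + e1 *> d != 0 by apply: (@dual_neq0 x); rewrite hformE !G ?e1x; rewrite hformE G mul0r addr0 oner_neq0.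
  have nre : ray (e2 + e1 *> d) <> ray e1 by rewrite -Er -E1.
  rewrite (plane_of_neq li lr le1 r0 e10 nre).
  apply: span_cvg_plane => //; [exact: indep_of_neq| |exact: cvg_perturbT].
  by rewrite /p3 gE /deform; under eq_fun do rewrite perturb_rscale; exact: cvg_perturbT.
- by rewrite E1; apply: span_cvg_ray => //; exact: cvg_perturbT.
- exact: span_cvg_cst_plane.
- exact: span_cvg_cst_point il.
- exact: span_cvg_cst_plane.
- exact: span_cvg_cst_point iq.
- by rewrite lE; apply: span_cvg_plane => //; [rewrite gE; exact: cvg_deform|exact: cvg_cstV].
- have r0 : e2 + e1 *> d != 0 by apply: (@dual_neq0 x); rewrite !hformE !G !simp0 oner_neq0.
  rewrite Er; apply: span_cvg_ray => //.
  by rewrite /p3 gE /deform; under eq_fun do rewrite perturb_rscale; exact: cvg_perturbT.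
Qed.

(** * Stars with two equal branches *)

(** Moving the first visit of p along l makes a fork. *)
Lemma limit_star_adjacent l la lb p : inc p l -> inc p la -> inc p lb ->
  limit_walk l p l p la p lb p.
Proof.
move=> il ia ib; have [pn [pnP cpn]] := point_perturb p il.
apply: (@limit_step (fun=> l) pn (fun=> l) (fun=> p) (fun=> la) (fun=> p)
  (fun=> lb) (fun=> p)) => //;
  try by [exact: span_cvg_cst_plane (inc_plane il)|exact: span_cvg_cst_plane (inc_plane ia)
    |exact: span_cvg_cst_plane (inc_plane ib)|exact: span_cvg_cst_point il].
by move=> n; have [? ?] := pnP n; apply: limit_fork => //; exact: nesym.
Qed.

(** The point p moves to q = e1 + e2 t on l, for its first two visits only, and
    l1 moves to a line through q, which is opposite to l3. *)
Lemma limit_star_opposite_transversal l l1 l3 p : inc p l -> inc p l1 -> inc p l3 ->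
  l1 <> l -> l3 <> l -> limit_walk l p l1 p l p l3 p.
Proof.
move=> il i1 i3 n1 n3.
have li := inc_plane il; have l1i := inc_plane i1; have l3i := inc_plane i3.
have [e1 [e10 le1 e11 E1]] := inc_vec il.
have [e2 [le2 i12 lE]] := plane_extend Kdiv li.1 le1 e10.
have e12 := isotropic2_perp li le1 le2; have e22 := isotropic2_perp li le2 le2.
have [e20 n12] : e2 != 0 /\ ray e1 <> ray e2.
  have [f1 [f2 [u H]]] := exists_frame i12 e11 e12 e22; have G := gram H.
  split; first by apply: (@dual_neq0 f2); rewrite G oner_neq0.
  by apply: (@ray_neq f2); rewrite G ?oner_neq0.
have l1e1 := inc_eq_vec i1 E1; have l3e1 := inc_eq_vec i3 E1.
have [x [l1x e2x n1x l1E]] := transversal li l1i le1 l1e1 e10 le2 e20 n12 n1.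
have [y [l3y e2y n1y l3E]] := transversal li l3i le1 l3e1 e10 le2 e20 n12 n3.
have e1x := isotropic2_perp l1i l1e1 l1x; have xx := isotropic2_perp l1i l1x l1x.
have e1y := isotropic2_perp l3i l3e1 l3y.
have [f1 [u H]] := exists_frame_extending i12 e11 e12 e22 e1x e2x xx.
have G := gram H.
pose q n := perturb e1 e2 0 (T n).
pose x' n := perturb x (- f1) 0 (T n).
have lq n : l (q n) by exact: perturb_in.
have q0 n : q n != 0 by exact: perturb_neq0.
have e1q n : phi e1 (q n) = 0 by exact: (isotropic2_perp li).
have e2q n : phi e2 (q n) = 0 by exact: (isotropic2_perp li).
have xq n : phi x (q n) = (T n)%:A by rewrite /q pertr !G !simp0.
have f1q n : phi f1 (q n) = 1 by rewrite /q pertr !G !simp0.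
have e1x' n : phi e1 (x' n) = - (T n)%:A.
  by rewrite /x' pertr hformE !G ?e1x !simp0 scalerN.
have f1x' n : phi f1 (x' n) = 0.
  by rewrite /x' pertr hformE !G oppr0 !simp0.
have e2x' n : phi e2 (x' n) = 1.
  by rewrite /x' pertr hformE !G oppr0 !simp0.
have qq n : phi (q n) (q n) = 0 by exact: (isotropic2_perp li).
have qx' n : phi (q n) (x' n) = 0.
  by rewrite /q pertl e1x' e2x' !simp0 addNr.
have x'x' n : phi (x' n) (x' n) = 0.
  by rewrite /x' pertl !pertr !hformE !G ?xx !simp0 !oppr0 !simp0.
have iqx' n : indep (q n) (x' n).
  by apply: (@indep_dual f1 e2); rewrite ?f1q ?e2x' ?oner_neq0.
have mi n : isotropic_dim phi 2 (plane (q n) (x' n)) by exact: isotropic_plane.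
have T0 n : (T n)%:A != 0 :> K by rewrite scaler_eq0 oner_eq0 orbF T_neq0.
have D n : opposite_lines (plane (q n) (x' n)) l3.
  move=> w [al [be ->]]; rewrite l3E => -[c [d E]].
  have be0 : be = 0.
    have := congr1 (phi e1) E; rewrite !hform_comb e1q e1x' e11 e1y !simp0 => E'.
    by apply: (mulf0 Kdiv E'); rewrite oppr_eq0.
  have d0 : d = 0.
    have := congr1 (phi e2) E; rewrite !hform_comb e2q e2x' be0 e2y !G !simp0 mul1r.
    exact: esym.
  have al0 : al = 0.
    have := congr1 (phi x) E; rewrite !hform_comb xq be0 d0 !G !simp0 => E'.
    exact: (mulf0 Kdiv E').
  by rewrite al0 be0 !rscale0 addr0.
apply: (@limit_step (fun=> l) (fun n => ray (q n)) (fun n => plane (q n) (x' n))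
  (fun n => ray (q n)) (fun=> l) (fun=> p) (fun=> l3) (fun=> p)).
- move=> n; apply: limit_opp_lines_shift => //; split=> //; split=> //.
  + exact: inc_ray.
  + by apply: inc_ray => //; exact: plane_meml.
  + by apply: inc_ray => //; exact: plane_meml.
  + exact: inc_ray.
- by split.
- exact: span_cvg_cst_plane.
- by rewrite E1; apply: span_cvg_ray => //; exact: cvg_perturbT.
- rewrite l1E; apply: span_cvg_plane => //; [|exact: cvg_perturbT..].
  apply: indep_of_neq => //; apply: (@dual_neq0 e2); by rewrite e2x oner_neq0.
- by rewrite E1; apply: span_cvg_ray => //; exact: cvg_perturbT.
- exact: span_cvg_cst_plane.
- exact: span_cvg_cst_point il.
- exact: span_cvg_cst_plane.
- exact: span_cvg_cst_point il.
Qed.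

Lemma limit_star_opposite l l1 l3 p : inc p l -> inc p l1 -> inc p l3 ->
  limit_walk l p l1 p l p l3 p.
Proof.
move=> il i1 i3.
have [an [anP can]] := line_perturb l i1; have [bn [bnP cbn]] := line_perturb l i3.
apply: (@limit_step (fun=> l) (fun=> p) an (fun=> p) (fun=> l) (fun=> p) bn (fun=> p)) => //;
  try by [exact: span_cvg_cst_plane (inc_plane il)|exact: span_cvg_cst_point il].
by move=> n; have [? ?] := anP n; have [? ?] := bnP n; exact: limit_star_opposite_transversal.
Qed.

(** Moving l1 away from l and q, r away from p makes a cofork. *)
Lemma limit_costar_adjacent l p q r : inc p l -> inc q l -> inc r l ->
  limit_walk l p l p l q l r.
Proof.
move=> ip iq ir; have [ln [lnP cln]] := line_perturb l ip.
have [qn [qnP cqn]] := point_perturb p iq; have [rn [rnP crn]] := point_perturb p ir.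
apply: (@limit_step (fun=> l) (fun=> p) ln (fun=> p) (fun=> l) qn (fun=> l) rn) => //;
  try by [exact: span_cvg_cst_plane (inc_plane ip)|exact: span_cvg_cst_point ip].
by move=> n; have [? ?] := lnP n; have [? ?] := qnP n; have [? ?] := rnP n; exact: limit_cofork.
Qed.

(** The lines l1 and l2 rotate together around p and carry q away from l; then q
    and r are no longer orthogonal. *)
Lemma limit_costar_opposite_distinct l p q r : inc p l -> inc q l -> inc r l ->
  q <> p -> r <> p -> limit_walk l p l q l p l r.
Proof.
move=> ip iq ir nq nr; have li := inc_plane ip.
have [e1 [e10 le1 e11 E1]] := inc_vec ip.
have [e2 [e20 le2 e22 E2]] := inc_vec iq.
have n12 : ray e1 <> ray e2 by rewrite -E1 -E2; exact: nesym.
have e12 := isotropic2_perp li le1 le2.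
have i12 := indep_of_neq e10 e20 n12.
have lE := plane_of_neq li le1 le2 e10 e20 n12.
have nr1 : r <> ray e1 by rewrite -E1.
have [v [c [k [v0 lv Ev vE k0]]]] := point_coordinates lE e10 ir nr1.
have [f1 [f2 [u H]]] := exists_frame i12 e11 e12 e22; have G := gram H.
have [g gE] : exists g : nat -> V, g = deform e2 u f2 by exists (deform e2 u f2).
have gP n : [/\ phi (g n) (g n) = 0, phi e2 (g n) != 0, phi e1 (g n) = 0,
    phi f1 (g n) = 0 & phi f2 (g n) = 1] by rewrite gE; exact: deformP n (frame_swap H).
have g0 n : g n != 0.
  by have [_ ? _ _ _] := gP n; exact: (@dual_neq0 e2).
have i1g n : indep e1 (g n).
  by have [_ ? _ ? _] := gP n; apply: (@indep_dual f1 e2); rewrite ?G ?oner_neq0.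
have mi n : isotropic_dim phi 2 (plane e1 (g n)).
  by have [? _ ? _ _] := gP n; exact: isotropic_plane.
apply: (@limit_step (fun=> l) (fun=> p) (fun n => plane e1 (g n)) (fun n => ray (g n))
  (fun n => plane e1 (g n)) (fun=> p) (fun=> l) (fun=> r)).
- move=> n; have ipm : inc p (plane e1 (g n)).
    by rewrite E1; apply: inc_ray => //; exact: plane_meml.
  have igm : inc (ray (g n)) (plane e1 (g n)).
    by apply: inc_ray => //; exact: plane_memr.
  do 3!apply: limit_rot; apply: limit_opp_points => // /(_ (g n) v).
  rewrite Ev => /(_ (ray_mem _) (ray_mem _)).
  have [_ /eqP e2g e1g _ _] := gP n.
  rewrite vE !hformE (hform_eq0 e1g) mul0r add0r => E; apply: e2g; apply: hform_eq0.
  by apply/eqP; apply: contraNT k0 => g2; apply/eqP; exact: (mulf0 Kdiv E).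
- by split.
- exact: span_cvg_cst_plane.
- exact: span_cvg_cst_point ip.
- by rewrite lE; apply: span_cvg_plane => //; [exact: cvg_cstV|rewrite gE; exact: cvg_deform].
- by rewrite E2; apply: span_cvg_ray => //; rewrite gE; exact: cvg_deform.
- by rewrite lE; apply: span_cvg_plane => //; [exact: cvg_cstV|rewrite gE; exact: cvg_deform].
- exact: span_cvg_cst_point ip.
- exact: span_cvg_cst_plane.
- exact: span_cvg_cst_point ir.
Qed.

Lemma limit_costar_opposite l p q r : inc p l -> inc q l -> inc r l ->
  limit_walk l p l q l p l r.
Proof.
move=> ip iq ir.
have [qn [qnP cqn]] := point_perturb p iq; have [rn [rnP crn]] := point_perturb p ir.
apply: (@limit_step (fun=> l) (fun=> p) (fun=> l) qn (fun=> l) (fun=> p) (fun=> l) rn) => //;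
  try by [exact: span_cvg_cst_plane (inc_plane ip)|exact: span_cvg_cst_point ip].
by move=> n; have [? ?] := qnP n; have [? ?] := rnP n; exact: limit_costar_opposite_distinct.
Qed.

(** * Classification of the degenerate walks *)

Lemma inc_line_eq l m p q : inc p l -> inc q l -> inc p m -> inc q m -> p <> q -> l = m.
Proof.
move=> pl ql pm qm pq.
have [u [u0 lu uu Eu]] := inc_vec pl; have [v [v0 lv vv Ev]] := inc_vec ql.
have uv : ray u <> ray v by rewrite -Eu -Ev.
rewrite (plane_of_neq (inc_plane pl) lu lv) //.
by rewrite -(plane_of_neq (inc_plane pm) (inc_eq_vec pm Eu) (inc_eq_vec qm Ev)).
Qed.

Lemma inc_triangle p q r l l' l'' : p <> q -> inc p l -> inc q l -> inc p l' ->
  inc r l' -> inc q l'' -> inc r l'' -> inc r l.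
Proof.
move=> pq pl ql pl' rl' ql'' rl''.
have [u [u0 lu uu Eu]] := inc_vec pl; have [v [v0 lv vv Ev]] := inc_vec ql.
have [w [w0 lw ww Ew]] := inc_vec rl'.
have uv : ray u <> ray v by rewrite -Eu -Ev.
rewrite Ew; apply: inc_ray => //; first exact: inc_plane pl.
apply: (isotropic_in (inc_plane pl) lu lv) => //.
  exact: isotropic2_perp (inc_plane pl') (inc_eq_vec pl' Eu) lw.
exact: isotropic2_perp (inc_plane ql'') (inc_eq_vec ql'' Ev) (inc_eq_vec rl'' Ew).
Qed.

Lemma inc_join p q l l' : p <> q -> perp p q -> inc p l -> inc q l' ->
  exists m, inc p m /\ inc q m.
Proof.
move=> pq P pl ql'.
have [u [u0 lu uu Eu]] := inc_vec pl; have [v [v0 lv vv Ev]] := inc_vec ql'.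
have uv : ray u <> ray v by rewrite -Eu -Ev.
have mi : isotropic_dim phi 2 (plane u v).
  apply: isotropic_plane => //; first exact: indep_of_neq.
  by apply: P; rewrite ?Eu ?Ev; exact: ray_mem.
exists (plane u v); rewrite Eu Ev; split; apply: inc_ray => //.
  exact: plane_meml.
exact: plane_memr.
Qed.

(** Together with four_lines_through_point, these are the walks whose image is a
    quadripod. *)
Definition four_points_on_line l0 p0 l1 p1 l2 p2 l3 p3 :=
  [/\ l0 = l1, l0 = l2, l0 = l3 & [/\ p0 <> p1, p0 <> p2, p0 <> p3 & [/\ p1 <> p2, p1 <> p3 & p2 <> p3]]].

Definition four_lines_through_point l0 p0 l1 p1 l2 p2 l3 p3 :=
  [/\ p0 = p1, p0 = p2, p0 = p3 & [/\ l0 <> l1, l0 <> l2, l0 <> l3 & [/\ l1 <> l2, l1 <> l3 & l2 <> l3]]].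

(** The absence of triangles puts p3 on the line m of p0 and p2, and each of the
    lines l2, l3, l0 that joins two distinct points of m equals m. What remains
    is a fork around p0, a cofork, a costar, or two opposite lines l1, l3. *)
Lemma limit_collinear_fold m l0 p0 l1 l2 p2 l3 p3 : inc p0 m -> inc p2 m -> p0 <> p2 ->
  closed_walk l0 p0 l1 p0 l2 p2 l3 p3 -> limit_walk l0 p0 l1 p0 l2 p2 l3 p3.
Proof.
move=> m0 m2 p02 [[i00 i01] [_ i12] [i22 i23] [i33 i30]].
have E2 : l2 = m by exact: (inc_line_eq i12 i22 m0 m2).
subst l2; have m3 : inc p3 m by exact: (inc_triangle p02 m0 m2 i00 i30 i23 i33).
have [E30|n30] := pselect (p3 = p0).
  subst p3; have E3 : l3 = m by exact: (inc_line_eq i33 i23 m0 m2).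
  subst l3; do 2!apply: limit_rot; exact: limit_fork.
have E0 : l0 = m by exact: (inc_line_eq i30 i00 m3 m0).
subst l0; have [E1|n1] := pselect (l1 = m).
  subst l1; have [E3|n3] := pselect (l3 = m); first by subst l3; exact: limit_costar_adjacent.
  have E32 : p3 = p2.
    by apply: contrapT => n32; apply: n3; exact: (inc_line_eq i33 i23 m3 m2).
  subst p3; do 2!apply: limit_rot; apply: limit_cofork => //.
have [E3|n3] := pselect (l3 = m).
  by subst l3; apply: limit_cofork => //; exact: nesym.
have E32 : p3 = p2.
  by apply: contrapT => n32; apply: n3; exact: (inc_line_eq i33 i23 m3 m2).
subst p3; apply: limit_opp_lines_shift; first by split.
have [u [u0 mu uu Eu]] := inc_vec m0; have [v [v0 mv vv Ev]] := inc_vec m2.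
move=> w l1w l3w; apply/eqP/negPn/negP => w0.
have iw1 := inc_ray (inc_plane i01) l1w w0; have iw3 := inc_ray (inc_plane i23) l3w w0.
have iwm : inc (ray w) m by exact: (inc_triangle p02 m0 m2 i01 iw1 i23 iw3).
have [Ew|nw] := pselect (ray w = p0).
  by apply: n3; apply: (inc_line_eq (p := p0) (q := p2)) => //; rewrite -Ew.
by apply: n1; exact: (inc_line_eq iw1 i01 iwm m0).
Qed.

(** All the points lie on the line m of p0 and p2. If p1 or p3 is one of p0 and p2,
    a symmetry of the octagon leads to limit_collinear_fold; otherwise all the
    lines are equal to m. *)
Lemma limit_collinear l0 p0 l1 p1 l2 p2 l3 p3 : p0 <> p2 ->
  closed_walk l0 p0 l1 p1 l2 p2 l3 p3 ->
  ~ four_points_on_line l0 p0 l1 p1 l2 p2 l3 p3 ->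
  limit_walk l0 p0 l1 p1 l2 p2 l3 p3.
Proof.
move=> p02 W NQ; have [P|] := pselect (perp p0 p2); last exact: limit_opp_points.
have [[i00 i01] [i11 i12] [i22 i23] [i33 i30]] := W.
have [m [m0 m2]] := inc_join p02 P i00 i22.
have m1 : inc p1 m by exact: (inc_triangle p02 m0 m2 i01 i11 i22 i12).
have m3 : inc p3 m by exact: (inc_triangle p02 m0 m2 i00 i30 i23 i33).
have [E10|n10] := pselect (p1 = p0); first by subst p1; exact: (limit_collinear_fold m0 m2).
have [E12|n12] := pselect (p1 = p2).
  subst p1; apply: limit_rev; apply: (limit_collinear_fold m2 m0); first exact: nesym.
  exact: closed_walk_rev.
have [E32|n32] := pselect (p3 = p2).
  subst p3; do 2!apply: limit_rot; apply: (limit_collinear_fold m2 m0); first exact: nesym.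
  by do 2!apply: closed_walk_rot.
have [E30|n30] := pselect (p3 = p0).
  subst p3; do 2!apply: limit_rot; apply: limit_rev; apply: (limit_collinear_fold m0 m2) => //.
have E1 : l1 = m by exact: (inc_line_eq i11 i01 m1 m0).
have E2 : l2 = m by exact: (inc_line_eq i12 i22 m1 m2).
have E3 : l3 = m by exact: (inc_line_eq i33 i23 m3 m2).
have E0 : l0 = m by exact: (inc_line_eq i30 i00 m3 m0).
subst l0 l1 l2 l3.
have [E13|n13] := pselect (p1 = p3).
  by subst p3; do 3!apply: limit_rot; exact: limit_costar_opposite.
by case: NQ; split=> //; split=> //; try split; try exact: nesym.
Qed.

(** If p0 <> p2 or p1 <> p3, a rotation leads to limit_collinear. If p0 = p2 and
    p1 = p3 are distinct points, the four lines are equal; if they are the same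
    point, the walk is a star. *)
Lemma limit_closed_walk l0 p0 l1 p1 l2 p2 l3 p3 :
  closed_walk l0 p0 l1 p1 l2 p2 l3 p3 ->
  ~ four_points_on_line l0 p0 l1 p1 l2 p2 l3 p3 ->
  ~ four_lines_through_point l0 p0 l1 p1 l2 p2 l3 p3 ->
  limit_walk l0 p0 l1 p1 l2 p2 l3 p3.
Proof.
move=> W NQ NC; have [p02|n02] := pselect (p0 = p2); last exact: limit_collinear.
have [p13|n13] := pselect (p1 = p3); last first.
  do 3!apply: limit_rot; apply: limit_collinear => //; first exact: closed_walk_rot.
  move=> [e1 e2 e3 [n1 n2 n3 [n4 n5 n6]]]; apply: NQ.
  by split; try congruence; split; try congruence; split; congruence.
subst p2 p3; have [[i00 i01] [i11 i12] [i22 i23] [i33 i30]] := W.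
have [p01|n01] := pselect (p0 = p1); last first.
  have E1 : l1 = l0 by exact: (inc_line_eq i01 i11 i00 i30).
  have E2 : l2 = l0 by exact: (inc_line_eq i22 i12 i00 i30).
  have E3 : l3 = l0 by exact: (inc_line_eq i23 i33 i00 i30).
  by subst l1 l2 l3; exact: limit_costar_opposite.
subst p1.
have [E|n1] := pselect (l0 = l1); first by subst l1; exact: limit_star_adjacent.
have [E|n2] := pselect (l1 = l2); first by subst l2; do 3!apply: limit_rot; exact: limit_star_adjacent.
have [E|n3] := pselect (l2 = l3); first by subst l3; do 2!apply: limit_rot; exact: limit_star_adjacent.
have [E|n4] := pselect (l0 = l3); first by subst l3; apply: limit_rot; exact: limit_star_adjacent.
have [E|n5] := pselect (l0 = l2); first by subst l2; exact: limit_star_opposite.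
have [E|n6] := pselect (l1 = l3); first by subst l3; apply: limit_rot; exact: limit_star_opposite.
by case: NC.
Qed.

End HermitianGeometry.

(** * Small scalars fixed by the involution *)

Section SmallScalar.
Context {R : realType} {F : fieldType} (a : absolute_value R F).
Context {K : falgType F} {sigma : K -> K}.
Hypothesis sigmaD : {morph sigma : x y / x + y}.
Hypothesis sigmaM : forall x y, sigma (x * y) = sigma y * sigma x.
Hypothesis sigmaK : involutive sigma.

Lemma algA_inj (c d : F) : c%:A = d%:A :> K -> c = d.
Proof.
move/eqP; rewrite -subr_eq0 -scalerBl scaler_eq0 oner_eq0 orbF subr_eq0.
by move/eqP.
Qed.

Lemma absvV (x : F) : a x^-1 = (a x)^-1.
Proof.
have [->|x0] := eqVneq x 0.
  by rewrite invr0 (iffRL (absv_eq0 a 0) erefl) invr0.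
have ax0 : a x != 0 by apply: contraNneq x0 => /absv_eq0 ->.
by apply: (mulfI ax0); rewrite -absvM !divff // absv1.
Qed.

(** Otherwise every nonzero fixed scalar has absolute value 1. Some y in F has
    |y| > 2. Both y sigma(y) and y + sigma(y) are fixed, so |sigma(y)| = 1 / |y|
    and |y + sigma(y)| <= 1, which contradicts the triangle inequality. *)
Lemma exists_small_fixed_scalar :
  (exists2 x, x != 0 & a x != 1) ->
  (forall c : F, exists d : F, sigma c%:A = d%:A) ->
  exists e : F, [/\ e != 0, a e < 1 & sigma e%:A = e%:A].
Proof.
move=> [x0 x0n ax0] sF; apply: contrapT => noe.
have fixed1 e : e != 0 -> sigma e%:A = e%:A -> a e = 1.
  move=> e0 se; apply/eqP; rewrite eq_le; apply/andP; split; last first.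
    by rewrite leNgt; apply/negP => lt; apply: noe; exists e.
  have sV : sigma (e^-1)%:A = (e^-1)%:A.
    have eu : (e%:A : K) * (e^-1)%:A = 1 by rewrite mulr_algl scalerA divff // scale1r.
    have s1 : sigma 1 = 1 by have := sigmaM (sigma 1) 1; rewrite mulr1 sigmaK mulr1 => <-.
    have := congr1 sigma eu; rewrite sigmaM se s1 mulr_algr => E.
    have : e^-1 *: (e *: sigma (e^-1)%:A) = (e^-1)%:A by rewrite E.
    by rewrite scalerA mulVf // scale1r.
  have e0' : e^-1 != 0 by rewrite invr_eq0.
  rewrite leNgt; apply/negP => lt; apply: noe; exists e^-1; split=> //.
  by rewrite absvV invf_lt1 // lt_neqAle eq_sym absv_ge0 andbT; apply: contraNneq e0 => /absv_eq0 ->.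
have [x xn ax] : exists2 x, x != 0 & a x < 1.
  have [lt|gt|E] := ltgtP (a x0) 1; first by exists x0.
    exists x0^-1; first by rewrite invr_eq0.
    by rewrite absvV invf_lt1 // (lt_trans ltr01).
  by rewrite E eqxx in ax0.
have [k wk] : exists k, a x ^+ k < 2^-1.
  have cv : (a x ^+ n : R^o) @[n --> \oo] --> (0 : R^o).
    by apply: cvg_expr; rewrite ger0_norm ?absv_ge0.
  have h0 : 0 < 2^-1 :> R by rewrite invr_gt0.
  have /cvgr0Pnorm_lt/(_ _ h0)[N _ HN] := cv.
  exists N; have := HN N (leqnn N) ; by rewrite /= ger0_norm ?exprn_ge0 ?absv_ge0.
pose y := (x ^+ k)^-1.
have y0 : y != 0 by rewrite invr_eq0 expf_neq0.
have ay : 2 < a y.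
  rewrite absvV absvX -[2]invrK ltf_pV2 //; rewrite posrE ?invr_gt0 //.
  rewrite exprn_gt0 // lt_neqAle eq_sym absv_ge0 andbT.
  by apply: contraNneq xn => /absv_eq0 ->.
have [d sy] := sF y.
have sd : sigma d%:A = y%:A by rewrite -sy sigmaK.
have d0 : d != 0.
  apply: contraNneq y0 => d0; apply/eqP/algA_inj; rewrite -sd d0.
  by rewrite scale0r; apply: (addrI (sigma 0)); rewrite -sigmaD !addr0.
have aN : a y * a d = 1.
  rewrite -absvM; apply: fixed1; first by rewrite mulf_neq0.
  have -> : ((y * d)%:A : K) = y%:A * d%:A by rewrite mulr_algl scalerA.
  by rewrite sigmaM sd sy.
have aT : a (y + d) <= 1.
  have [->|T0] := eqVneq (y + d) 0; first by rewrite (iffRL (absv_eq0 a 0) erefl).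
  rewrite fixed1 // scalerDl sigmaD sy sd addrC //.
have ad : a d < 1.
  rewrite ltNge; apply/negP => ad1.
  have : 1 < a y * a d by apply: (lt_le_trans (lt_trans _ ay)); [rewrite ltr1n|rewrite ler_peMr ?absv_ge0].
  by rewrite aN ltxx.
have : a y < 2.
  have -> : y = (y + d) + (- d) by rewrite addrK.
  apply: (le_lt_trans (absvD _ _ _)); rewrite absvN.
  by have -> : 2 = 1 + 1 :> R by []; apply: ler_ltD.
by move=> /(lt_trans ay); rewrite ltxx.
Qed.

End SmallScalar.

(** Commuting with i kills the coefficients of j and ij, and commuting with j kills
    the coefficient of i; here 2 must be invertible. *)
Lemma quaternion_center (F : fieldType) (K : falgType F) (x : K) :
  2%N \notin [pchar F] -> quaternion_algebra K -> (forall y, x * y = y * x) ->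
  exists c : F, x = c%:A.
Proof.
move=> ch2 [c [d [i [j [c0 d0 [ii jj ij B]]]]]] xc.
have two0 : (2%:R : F) != 0 by apply: contra ch2 => E; rewrite inE.
have /andP[/eqP spanB freeB] := B.
pose X := [tuple 1; i; j; i * j].
have free4 (p q r s : F) : p *: 1 + q *: i + r *: j + s *: (i * j) = 0 ->
    [/\ p = 0, q = 0, r = 0 & s = 0].
  move=> E; have /freeP/(_ (tnth [tuple p; q; r; s])) : free X by [].
  rewrite !big_ord_recl big_ord0 /= !(tnth_nth 0) /= addr0 !addrA => /(_ E) H.
  by split; [have := H 0|have := H (inord 1)|have := H (inord 2)|have := H (inord 3)];
    rewrite (tnth_nth 0) /= ?inordK.
have xX : x \in <<X>>%VS by rewrite /X /= spanB memvf.
have := coord_span xX; rewrite !big_ord_recl big_ord0 /= addr0 !addrA.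
set p := coord _ _ _; set q := coord _ _ _; set r := coord _ _ _; set s := coord _ _ _.
move=> xE.
have ji : j * i = - (i * j) by rewrite ij opprK.
have [] : [/\ (0 : F) = 0, (0 : F) = 0, (s + s) * c = 0 & r + r = 0].
  apply: free4; rewrite !scale0r !add0r.
  have := xc i; rewrite xE !(mulrDl, mulrDr) -!scalerAl -!scalerAr mul1r mulr1.
  have -> : i * j * i = - c *: j by rewrite -mulrA ji mulrN mulrA ii mulr_algl scaleNr.
  have -> : i * (i * j) = c *: j by rewrite mulrA ii mulr_algl.
  rewrite ji -!addrA => /addrI/addrI E.
  rewrite !scalerDl addrACA -!scalerA ![s *: _ + _]addrC -{1}E.
  by rewrite scalerN scaleNr scalerN -opprD addNr.
move=> _ _ /eqP; rewrite mulf_eq0 (negbTE c0) orbF -mulr2n -mulr_natr mulf_eq0 (negbTE two0) orbF => /eqP s0.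
move=> /eqP; rewrite -mulr2n -(mulr_natr r) mulf_eq0 (negbTE two0) orbF => /eqP r0.
have [] : [/\ (0 : F) = 0, (0 : F) = 0, (0 : F) = 0 & q + q = 0].
  apply: free4; rewrite !scale0r !add0r.
  have := xc j; rewrite xE r0 s0 !scale0r !addr0 !(mulrDl, mulrDr) -!scalerAl -!scalerAr mul1r mulr1.
  rewrite ji => /addrI E; rewrite scalerDl {1}E scalerN addNr //.
move=> _ _ _ /eqP; rewrite -mulr2n -(mulr_natr q) mulf_eq0 (negbTE two0) orbF => /eqP q0.
by exists p; rewrite xE r0 s0 q0 !scale0r !addr0.
Qed.


Lemma eq_cycle4 (X : Type) (h : 'I_4 -> X) :
  h = cycle4 (h 0) (h 1) (h (inord 2)) (h (inord 3)).
Proof.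
apply/funext => -[[|[|[|[|//]]]] i]; rewrite /cycle4 /=; congr h; apply/val_inj => //=;
by rewrite inordK.
Qed.

Lemma cycle4_const (X : Type) (x0 x1 x2 x3 : X) i j :
  x0 = x1 -> x0 = x2 -> x0 = x3 -> cycle4 x0 x1 x2 x3 i = cycle4 x0 x1 x2 x3 j.
Proof. by move=> <- <- <-; case: i j => [[|[|[|[|//]]]] ?] [[|[|[|[|//]]]] ?]. Qed.

Theorem theorem3 (R : realType) (F : fieldType) (a : absolute_value R F)
  (K : falgType F) (sigma : {rmorphism K -> K^c}) (V : vectType K^c)
  (phi : hermitian_form V sigma) (A : set (grass 1 V * grass 2 V)) :
  local_field a ->
  2%N \notin [pchar F] ->
  is_base_field K \/ (quaternion_algebra K /\ division_algebra K) ->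
  involutive (sigma : K -> K) ->
  (quaternion_algebra K -> ~ hamilton_quaternion K R ->
     standard_involution sigma) ->
  (5 <= dim V)%N ->
  nondegenerate_form phi ->
  witt_index phi 2 ->
  apartment phi A ->
  forall f : mor phi A, ~ quadripod phi (mor_image f) ->
    @closure (mor_top a phi A) (mor_inj (phi := phi) (A := A)) f.
Proof.
move=> [nontriv _ _] char2 Ktype sigmaK _ dimV nondeg witt [_ [L [P [Linj Pinj AE]]]] f nq.
have sigmaD : {morph (sigma : K -> K) : x y / x + y} by move=> x y; exact: (rmorphD sigma).
have sigmaM (x y : K) : (sigma (x * y) : K) = (sigma y : K) * (sigma x : K).
  exact: (rmorphM sigma).
have Kdiv : division_algebra K.
  case: Ktype => [KF x x0|[_ //]]; have [c xE] := KF x.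
  have c0 : c != 0 by apply: contraNneq x0 => c0; rewrite xE c0 scale0r.
  apply/unitrP; exists (c^-1)%:A.
  by rewrite xE !mulr_algl !scalerA mulVf // divff // scale1r.
have sigmaF (c : F) : exists d : F, (sigma c%:A : K) = d%:A.
  case: Ktype => [KF|[Kq _]]; first exact: KF.
  apply: quaternion_center => // y.
  by rewrite -[y]sigmaK -!sigmaM mulr_algl mulr_algr.
have [eps [eps0 eps1 sigma_eps]] :=
  exists_small_fixed_scalar (sigma := sigma : K -> K) sigmaD sigmaM sigmaK nontriv sigmaF.
set p := line_images AE f; set l := plane_images AE f.
apply: (limit_circuit_closure Linj Pinj (p := p) (l := l)) => //.
have c : circuit phi p l := circuit_images AE f.
have W : closed_walk phi (l 0) (p 0) (l 1) (p 1) (l (inord 2)) (p (inord 2))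
    (l (inord 3)) (p (inord 3)).
  have o1 : ordS (0 : 'I_4) = 1 by exact/val_inj.
  have o2 : ordS (1 : 'I_4) = inord 2 by apply/val_inj; rewrite /= inordK.
  have o3 : ordS (inord 2 : 'I_4) = inord 3 by apply/val_inj; rewrite /= !inordK.
  have o4 : ordS (inord 3 : 'I_4) = 0 by apply/val_inj; rewrite /= !inordK.
  have inc_same i : inc phi (p i) (l i) by have [] := c i.
  have inc_next i j : ordS i = j -> inc phi (p i) (l j).
    by move=> <-; have [? _ _ ?] := c i; have [] := c (ordS i).
  by split; split; auto.
rewrite [p]eq_cycle4 [l]eq_cycle4.
apply: (limit_closed_walk Kdiv char2 sigmaD sigmaM sigmaK nondeg witt dimV eps0 eps1 sigma_eps W).
- move=> [e1 e2 e3 [n1 n2 n3 [n4 n5 n6]]]; apply: nq; apply: (quadripod_inside_plane (AE := AE)).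
    move=> i j; apply: gset_inj; rewrite -!/(plane_images AE f _) -/l [l]eq_cycle4.
    exact: cycle4_const.
  have : injective p by rewrite [p]eq_cycle4; apply: cycle4_inj.
  by move=> pinj i j E; apply: pinj; rewrite /p /line_images E.
- move=> [e1 e2 e3 [n1 n2 n3 [n4 n5 n6]]]; apply: nq; apply: (quadripod_around_line (AE := AE)).
    move=> i j; apply: gset_inj; rewrite -!/(line_images AE f _) -/p [p]eq_cycle4.
    exact: cycle4_const.
  have : injective l by rewrite [l]eq_cycle4; apply: cycle4_inj.
  by move=> linj i j E; apply: linj; rewrite /l /plane_images E.
Qed.
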